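(* Consider problem (P) and suppose Assumptions A, B and E hold. Let $\{x^t\}$ be generated by SCP$_{ls}$. Then $\{x^t\}$ converges to a minimizer $x^*$ of (P). If in addition $F$ is a KL function with exponent $\alpha\in[0,1)$, then: (i) if $\alpha\in[0,\frac12]$, there exist $c_0>0$, $Q_1\in(0,1)$ and $\underline t\in\mathbb N_+$ such that $\|x^t-x^*\|\le c_0Q_1^t$ for all $t>\underline t$; (ii) if $\alpha\in(\frac12,1)$, there exist $c_0>0$ and $\underline t\in\mathbb N_+$ such that $\|x^t-x^*\|\le c_0t^{-\frac{1-\alpha}{2\alpha-1}}$ for all $t>\underline t$.
   Context: Problem (P): $\min_{x\in\mathbb R^n}F(x):=f(x)+P_1(x)-P_2(x)+\delta_{\{g\le 0\}}(x)$, where $f:\mathbb R^n\to\mathbb R$ is continuously differentiable, $P_1,P_2:\mathbb R^n\to\mathbb R$ are convex and continuous, $g=(g_1,\dots,g_m):\mathbb R^n\to\mathbb R^m$ is continuous with $\{x:g(x)\le0\}\neq\emptyset$ (componentwise inequalities), $\delta_C$ the indicator function of $C$; $\partial$ is the limiting subdifferential. Assumption A: (i) $\nabla f$ is Lipschitz with modulus $L_f$; (ii) each $g_i$ is differentiable with $\nabla g_i$ Lipschitz with modulus $L_{g_i}$; (iii) $F$ is level-bounded. Assumption B (MFCQ): each $g_i$ is continuously differentiable and for every $x$ with $g(x)\le0$ there is $d$ with $\langle\nabla g_i(x),d\rangle<0$ for all $i\in I(x):=\{j:g_j(x)=0\}$. Assumption E: $P_2\equiv0$ and $f,g_1,\dots,g_m$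 are convex. KL property with exponent $\alpha\in[0,1)$: a proper closed $h$ has it at $\hat x\in{\rm dom}\,\partial h$ if there exist $a\in(0,\infty]$, a neighborhood $V$ of $\hat x$ and $a_0>0$ such that $a_0(1-\alpha)(h(x)-h(\hat x))^{-\alpha}\,{\rm dist}(0,\partial h(x))\ge1$ for all $x\in V$ with $h(\hat x)<h(x)<h(\hat x)+a$; $h$ is a KL function with exponent $\alpha$ if this holds at every point of ${\rm dom}\,\partial h$. $\bar G(x,y,w)\in\mathbb R^m$ has components $\bar G_i(x,y,w)=g_i(y)+\langle\nabla g_i(y),x-y\rangle+\frac{w_i}{2}\|x-y\|^2$. Algorithm SCP$_{ls}$: fix $c>0$, $0<\underline L<\bar L$, $\tau>1$ and $x^0$ with $g(x^0)\le0$. For $t=0,1,2,\dots$: (1) pick any $\xi^t\in\partial P_2(x^t)$; (2) choose $L_f^{t,0}\in[\underline L,\bar L]$, $L_g^{t,0}\in[\underline L,\bar L]^m$ arbitrarily, set $\tilde L_f=L_f^{t,0}$, $\tilde L_g=L_g^{t,0}$; (3) compute $\tilde x$ solving: minimize $\langle\nabla f(x^t)-\xi^t,x-x^t\rangle+\frac{\tilde L_f}{2}\|x-x^t\|^2+P_1(x)$ subject to $\bar G(x,x^t,\tilde L_g)\le0$. If $g(\tilde x)\le0$ and $F(\tilde x)\le F(x^t)-\frac c2\|\tilde x-x^t\|^2$, set $x^{t+1}=\tilde x$, $L_f^t=\tilde L_f$, $L_g^t=\tilde L_g$ and go to iteration $t+1$; otherwise, if $g(\tilde x)\not\le0$ replace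 $\tilde L_g$ by $\tau\tilde L_g$, while if $g(\tilde x)\le0$ but the decrease inequality fails replace $\tilde L_f$ by $\tau\tilde L_f$, and repeat step (3). *)

(* Defs.v *)
From Stdlib Require Import Reals.
From mathcomp Require Import all_boot.
Set Implicit Arguments.
Unset Strict Implicit.
Unset Printing Implicit Defensive.
Open Scope R_scope.

Definition vec (n : nat) := 'I_n -> R.

Definition vadd {n} (u v : vec n) : vec n := fun i => u i + v i.
Definition vsub {n} (u v : vec n) : vec n := fun i => u i - v i.
Definition vscale {n} (a : R) (u : vec n) : vec n := fun i => a * u i.
Definition vzero {n} : vec n := fun _ => 0.
Definition inner {n} (u v : vec n) : R := \big[Rplus/0]_(i < n) (u i * v i).
Definition vnorm {n} (u : vec n) : R := sqrt (inner u u).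

Definition vconv {n} (x : nat -> vec n) (l : vec n) : Prop :=
  Un_cv (fun k => vnorm (vsub (x k) l)) 0.

Definition convex_fun {n} (h : vec n -> R) : Prop :=
  forall x y lam, 0 <= lam <= 1 ->
    h (vadd (vscale lam x) (vscale (1 - lam) y)) <= lam * h x + (1 - lam) * h y.

Definition continuous_fun {n} (h : vec n -> R) : Prop :=
  forall x eps, 0 < eps -> exists delta, 0 < delta /\
    forall y, vnorm (vsub y x) < delta -> Rabs (h y - h x) < eps.

Definition continuous_map {n} (G : vec n -> vec n) : Prop :=
  forall x eps, 0 < eps -> exists delta, 0 < delta /\
    forall y, vnorm (vsub y x) < delta -> vnorm (vsub (G y) (G x)) < eps.

Definition has_grad {n} (h : vec n -> R) (x v : vec n) : Prop :=
  forall eps, 0 < eps -> exists delta, 0 < delta /\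
    forall y, vnorm (vsub y x) < delta ->
      Rabs (h y - h x - inner v (vsub y x)) <= eps * vnorm (vsub y x).

Definition lipschitz_map {n} (G : vec n -> vec n) (L : R) : Prop :=
  forall x y, vnorm (vsub (G x) (G y)) <= L * vnorm (vsub x y).

(* Extended-valued function represented by its effective domain D and its
   (finite) values h on D; it equals +infinity outside D.
   Frechet (regular) subdifferential: *)
Definition frechet_sub {n} (D : vec n -> Prop) (h : vec n -> R) (x v : vec n)
  : Prop :=
  D x /\ forall eps, 0 < eps -> exists delta, 0 < delta /\
    forall y, D y -> vnorm (vsub y x) < delta ->
      h x + inner v (vsub y x) - eps * vnorm (vsub y x) <= h y.

Definition limiting_sub {n} (D : vec n -> Prop) (h : vec n -> R) (x v : vec n)
  : Prop :=
  D x /\ exists (xk vk : nat -> vec n),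
    (forall k, frechet_sub D h (xk k) (vk k)) /\ vconv xk x /\
    Un_cv (fun k => h (xk k)) (h x) /\ vconv vk v.

(* a in (0, +infinity]: None stands for +infinity *)
Definition ext_pos (a : option R) : Prop :=
  match a with None => True | Some r => 0 < r end.
Definition below_ext (z : R) (a : option R) : Prop :=
  match a with None => True | Some r => z < r end.

(* KL property with exponent alpha at xh; dist(0, dh(x)) >= s is written
   as "every v in dh(x) has norm >= s" (inf over an empty set = +infinity). *)
Definition KL_at {n} (D : vec n -> Prop) (h : vec n -> R) (alpha : R)
  (xh : vec n) : Prop :=
  exists (a : option R) (r a0 : R), ext_pos a /\ 0 < r /\ 0 < a0 /\
    forall x, D x -> vnorm (vsub x xh) < r ->
      h xh < h x -> below_ext (h x - h xh) a ->
      forall v, limiting_sub D h x v ->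
        1 <= a0 * (1 - alpha) * Rpower (h x - h xh) (- alpha) * vnorm v.

Definition KL_function {n} (D : vec n -> Prop) (h : vec n -> R) (alpha : R)
  : Prop :=
  forall xh, (exists v, limiting_sub D h xh v) -> KL_at D h alpha xh.

Definition feasible {n m} (g : 'I_m -> vec n -> R) (x : vec n) : Prop :=
  forall i, g i x <= 0.

(* F restricted to its domain {g <= 0}: f + P1 - P2 *)
Definition Fval {n} (f P1 P2 : vec n -> R) (x : vec n) : R :=
  f x + P1 x - P2 x.

Definition level_bounded {n} (D : vec n -> Prop) (h : vec n -> R) : Prop :=
  forall r, exists B, forall x, D x -> h x <= r -> vnorm x <= B.

Definition is_minimizer {n m} (f P1 P2 : vec n -> R) (g : 'I_m -> vec n -> R)
  (x : vec n) : Prop :=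
  feasible g x /\ forall y, feasible g y -> Fval f P1 P2 x <= Fval f P1 P2 y.

Definition Gbar {n m} (g : 'I_m -> vec n -> R) (dg : 'I_m -> vec n -> vec n)
  (x y : vec n) (w : 'I_m -> R) (i : 'I_m) : R :=
  g i y + inner (dg i y) (vsub x y) + w i / 2 * inner (vsub x y) (vsub x y).

Definition sub_obj {n} (df : vec n -> vec n) (P1 : vec n -> R)
  (xt xi : vec n) (Lf : R) (x : vec n) : R :=
  inner (vsub (df xt) xi) (vsub x xt)
  + Lf / 2 * inner (vsub x xt) (vsub x xt) + P1 x.

Definition sub_sol {n m} (df : vec n -> vec n) (P1 : vec n -> R)
  (g : 'I_m -> vec n -> R) (dg : 'I_m -> vec n -> vec n)
  (xt xi : vec n) (Lf : R) (Lg : 'I_m -> R) (y : vec n) : Prop :=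
  (forall i, Gbar g dg y xt Lg i <= 0) /\
  forall z, (forall i, Gbar g dg z xt Lg i <= 0) ->
    sub_obj df P1 xt xi Lf y <= sub_obj df P1 xt xi Lf z.

Definition accept {n m} (f P1 P2 : vec n -> R) (g : 'I_m -> vec n -> R)
  (c : R) (xt y : vec n) : Prop :=
  feasible g y /\
  Fval f P1 P2 y <= Fval f P1 P2 xt - c / 2 * inner (vsub y xt) (vsub y xt).

(* One outer iteration of SCP_ls: x^t -> x^{t+1}.  The inner loop of step (3)
   runs for trials k = 0..K with parameters (Lf k, Lg k) and subproblem
   solutions xs k; trials k < K are rejected and the parameters updated as
   prescribed; trial K is accepted. *)
Definition SCP_step {n m} (f P1 P2 : vec n -> R) (df : vec n -> vec n)
  (g : 'I_m -> vec n -> R) (dg : 'I_m -> vec n -> vec n)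
  (c Lmin Lmax tau : R) (xt xnext : vec n) : Prop :=
  exists xi : vec n, limiting_sub (fun _ => True) P2 xt xi /\
  exists (K : nat) (Lf : nat -> R) (Lg : nat -> 'I_m -> R) (xs : nat -> vec n),
    Lmin <= Lf O <= Lmax /\ (forall i, Lmin <= Lg O i <= Lmax) /\
    (forall k, (k <= K)%N -> sub_sol df P1 g dg xt xi (Lf k) (Lg k) (xs k)) /\
    (forall k, (k < K)%N ->
       ~ accept f P1 P2 g c xt (xs k) /\
       ((~ feasible g (xs k) /\ Lf (S k) = Lf k /\
           Lg (S k) = (fun i => tau * Lg k i)) \/
        (feasible g (xs k) /\ Lf (S k) = tau * Lf k /\ Lg (S k) = Lg k))) /\
    accept f P1 P2 g c xt (xs K) /\ xnext = xs K.

Definition SCP_ls_sequence {n m} (f P1 P2 : vec n -> R) (df : vec n -> vec n)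
  (g : 'I_m -> vec n -> R) (dg : 'I_m -> vec n -> vec n)
  (c Lmin Lmax tau : R) (x : nat -> vec n) : Prop :=
  feasible g (x O) /\
  forall t, SCP_step f P1 P2 df g dg c Lmin Lmax tau (x t) (x (S t)).

(* Main.v *)
Require Import Defs.
From Stdlib Require Import Reals Lra Psatz FunctionalExtensionality ClassicalEpsilon.
From mathcomp Require Import all_boot.

(** Scaling the constraints of a subproblem to a common modulus of convexity, a single
    bounded multiplier (MFCQ gives a Slater point) turns the optimality of [x (S t)] into
    [F (x (S t)) <= F z + Lam / 2 * (|z - x t|^2 - |z - x (S t)|^2) + K * |x (S t) - x t|^2]
    for every feasible [z], with [Lam] bounded above and away from 0. Combined with
    sufficient decrease, [|z - x t|^2 + C * F (x t)] is a Lyapunov function for every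
    feasible [z] with [F z <= F (x s)] for all [s]; hence a cluster point is optimal and
    is the limit.

    For the rates, the KL inequality yields the error bound
    [dist (x, argmin F) <= A * (F x - min F)^(1 - alpha)] near the limit, by minimizing
    [(F z - min F)^(1 - alpha) + kappa / 2 * |z - x|^2] for a suitable [kappa]. Taking a
    nearby minimizer for [z] above gives, with [e t := F (x t) - min F] and
    [alpha >= 1 / 2], [e (S t)^(2 alpha) <= C (e t - e (S t))], while the Lyapunov
    function bounds the distance to the limit by a multiple of [e t ^ (1 - alpha)]. *)

Set Implicit Arguments.
Unset Strict Implicit.
Unset Printing Implicit Defensive.
Open Scope R_scope.

Ltac vec_ring :=
  apply: functional_extensionality => ?; rewrite /vadd /vsub /vscale /vzero; ring.

(** * Euclidean inner product and norm on coordinate vectors *)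

Section Vectors.
Context {n : nat}.
Implicit Types (u v w x y z : vec n) (a b : R).

Lemma innerC u v : inner u v = inner v u.
Proof. by rewrite /inner; apply: eq_bigr => i _; ring. Qed.

Lemma inner_addl u v w : inner (vadd u v) w = inner u w + inner v w.
Proof.
rewrite /inner; elim/big_rec3: _ => [|i a b c _ ->]; first by ring.
by rewrite /vadd; ring.
Qed.

Lemma inner_scalel a u w : inner (vscale a u) w = a * inner u w.
Proof.
rewrite /inner; elim/big_rec2: _ => [|i b c _ ->]; first by ring.
by rewrite /vscale; ring.
Qed.

Lemma inner_subl u v w : inner (vsub u v) w = inner u w - inner v w.
Proof.
have -> : vsub u v = vadd u (vscale (-1) v) by vec_ring.
by rewrite inner_addl inner_scalel; ring.
Qed.

Lemma inner_addr u v w : inner w (vadd u v) = inner w u + inner w v.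
Proof. by rewrite innerC inner_addl !(innerC w). Qed.

Lemma inner_scaler a u w : inner w (vscale a u) = a * inner w u.
Proof. by rewrite innerC inner_scalel (innerC w). Qed.

Lemma inner_subr u v w : inner w (vsub u v) = inner w u - inner w v.
Proof. by rewrite innerC inner_subl !(innerC w). Qed.

Definition innerE :=
  (inner_addl, inner_subl, inner_scalel, inner_addr, inner_subr, inner_scaler).

Lemma inner_ge0 u : 0 <= inner u u.
Proof.
rewrite /inner; elim/big_rec: _ => [|i a _ ?]; first lra.
have := Rle_0_sqr (u i); rewrite /Rsqr; lra.
Qed.

Lemma vnorm_ge0 u : 0 <= vnorm u.
Proof. exact: sqrt_pos. Qed.

Lemma vnorm_sq u : vnorm u * vnorm u = inner u u.
Proof. exact: sqrt_sqrt (inner_ge0 u). Qed.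

Lemma vnorm_le_sq u a : 0 <= a -> inner u u <= a * a -> vnorm u <= a.
Proof. by move=> a0; rewrite -vnorm_sq; have := vnorm_ge0 u; nra. Qed.

Lemma vnorm_lt_sq u a : 0 <= a -> inner u u < a * a -> vnorm u < a.
Proof. by move=> a0; rewrite -vnorm_sq; have := vnorm_ge0 u; nra. Qed.

Lemma cauchy_schwarz u v : inner u v <= vnorm u * vnorm v.
Proof.
have h : inner u v * inner u v <= inner u u * inner v v.
  have := inner_ge0 v; case=> [v0|v0].
    have := inner_ge0 (vsub (vscale (inner v v) u) (vscale (inner u v) v)).
    rewrite !innerE (innerC v u) => h.
    apply: (Rmult_le_reg_l (inner v v)) => //; lra.
  suff -> : inner u v = 0 by rewrite -v0; lra.
  (* When [inner v v = 0], [|u + t v|^2] is affine in [t]; being nonnegative for all [t], it has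
     slope 0. *)
  have P t : 0 <= inner u u + 2 * t * inner u v.
    have := inner_ge0 (vadd u (vscale t v)).
    by rewrite !innerE (innerC v u) -v0; lra.
  case: (Req_dec (inner u v) 0) => // ne.
  have := P (- (inner u u + 1) / (2 * inner u v)).
  have -> : inner u u + 2 * (- (inner u u + 1) / (2 * inner u v)) * inner u v = -1
    by field.
  lra.
have := vnorm_ge0 u; have := vnorm_ge0 v.
rewrite -!vnorm_sq in h => *.
have ? : 0 <= vnorm u * vnorm v by exact: Rmult_le_pos.
apply: Rsqr_incr_0_var => //; rewrite /Rsqr; lra.
Qed.

Lemma vnorm_add u v : vnorm (vadd u v) <= vnorm u + vnorm v.
Proof.
have := vnorm_ge0 u; have := vnorm_ge0 v; have := cauchy_schwarz u v.
move=> *; apply: vnorm_le_sq; first lra.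
by rewrite !innerE (innerC v u) -!vnorm_sq; lra.
Qed.

Lemma vnorm_scale a u : vnorm (vscale a u) = Rabs a * vnorm u.
Proof.
rewrite /vnorm !innerE -Rmult_assoc sqrt_mult_alt; last by have := Rle_0_sqr a.
by rewrite -/(Rsqr a) sqrt_Rsqr_abs.
Qed.

Lemma vnorm_subC u v : vnorm (vsub u v) = vnorm (vsub v u).
Proof. by rewrite /vnorm; congr sqrt; rewrite !innerE; ring. Qed.

Lemma vnorm_triangle v u w : vnorm (vsub u w) <= vnorm (vsub u v) + vnorm (vsub v w).
Proof.
have -> : vsub u w = vadd (vsub u v) (vsub v w) by vec_ring.
exact: vnorm_add.
Qed.

Lemma vnorm_le_add u v : vnorm u <= vnorm (vsub u v) + vnorm v.
Proof.
have {1}-> : u = vadd (vsub u v) v by vec_ring.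
exact: vnorm_add.
Qed.

Lemma vnorm_subxx u : vnorm (vsub u u) = 0.
Proof. by rewrite /vnorm -sqrt_0; congr sqrt; rewrite !innerE; ring. Qed.

Lemma coord_le_vnorm u i : Rabs (u i) <= vnorm u.
Proof.
rewrite -sqrt_Rsqr_abs; apply: sqrt_le_1_alt.
rewrite /inner unlock /reducebig.
have : i \in index_enum 'I_n by exact: mem_index_enum.
elim: (index_enum _) => [//|j s IH]; rewrite inE /=.
have h0 : 0 <= foldr (applybig \o (fun j => BigBody j Rplus true (u j * u j))) 0 s.
  by elim: s {IH} => [|k s IH] /=; [lra | have := Rle_0_sqr (u k); rewrite /Rsqr; lra].
have := Rle_0_sqr (u j); rewrite /Rsqr => hj.
case/orP=> [/eqP->|/IH]; rewrite /Rsqr /=; lra.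
Qed.

End Vectors.

(** * Sequential compactness *)

Lemma choice_fun {A B : Type} (Q : A -> B -> Prop) :
  (forall a, exists b, Q a b) -> exists h : A -> B, forall a, Q a (h a).
Proof.
move=> ex; exists (fun a => proj1_sig (constructive_indefinite_description _ (ex a))) => a.
exact: proj2_sig.
Qed.

Lemma Un_cv_bounded_dist (u w : nat -> R) l :
  (forall k, Rabs (u k - l) <= w k) -> Un_cv w 0 -> Un_cv u l.
Proof.
move=> h cw eps e0; have [N HN] := cw eps e0; exists N => k kN.
have := HN k kN; have := h k; rewrite /R_dist /Rdist => h1.
have := Rle_abs (w k - 0); lra.
Qed.

(** Subsequences are encoded by [k <= phi k] alone, without monotonicity; this suffices for limits
    and is stable under composition. *)
Lemma Un_cv_subseq (u : nat -> R) l (phi : nat -> nat) :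
  (forall k, (k <= phi k)%coq_nat) -> Un_cv u l -> Un_cv (fun k => u (phi k)) l.
Proof.
move=> hphi cu eps e0; have [N HN] := cu eps e0; exists N => k kN.
apply: HN; have := hphi k; lia.
Qed.

Lemma Un_cv_inv_S : Un_cv (fun k => / (INR k + 1)) 0.
Proof.
move=> eps e0; have [N [HN N0]] := archimed_cor1 eps e0; exists N => k kN.
have i0 := RinvN_pos k.
rewrite /R_dist /Rdist Rminus_0_r Rabs_pos_eq; last by lra.
apply: Rle_lt_trans HN; apply: Rinv_le_contravar; first exact: lt_0_INR.
have := le_INR _ _ kN; lra.
Qed.

Lemma bounded_subseq (u : nat -> R) B :
  (forall k, Rabs (u k) <= B) ->
  exists l (phi : nat -> nat),
    (forall k, (k <= phi k)%coq_nat) /\ Un_cv (fun k => u (phi k)) l.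
Proof.
move=> ub.
have [k|l Hl] := @Bolzano_Weierstrass u (fun r => - B <= r <= B) (compact_P3 _ _).
  by have := ub k; split_Rabs; lra.
have E k : exists p, (k <= p)%coq_nat /\ Rabs (u p - l) <= / (INR k + 1).
  have [] := Hl (disc l (RinvN k)) k.
    by exists (RinvN k) => y.
  by move=> p [kp hp]; exists p; split=> //; exact: Rlt_le.
have [phi Hphi] := choice_fun E.
exists l, phi; split=> [k|]; first by have [] := Hphi k.
apply: Un_cv_bounded_dist Un_cv_inv_S => k.
by have [] := Hphi k.
Qed.

Lemma Un_cv_sum {n} (a : nat -> vec n) :
  (forall i, Un_cv (fun k => a k i) 0) ->
  Un_cv (fun k => \big[Rplus/0]_(i < n) a k i) 0.
Proof.
move=> h.
suff H (s : seq 'I_n) : Un_cv (fun k => \big[Rplus/0]_(i <- s) a k i) 0 by exact: H.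
elim: s => [|i s IH].
  move=> eps e0; exists O => k _; rewrite big_nil /R_dist /Rdist Rminus_0_r Rabs_R0 //.
have := CV_plus _ _ _ _ (h i) IH; rewrite Rplus_0_r.
by under [X in _ -> Un_cv X _]functional_extensionality => k do rewrite big_cons.
Qed.

Lemma vconv_coord {n} (x : nat -> vec n) l :
  (forall i, Un_cv (fun k => x k i) (l i)) -> vconv x l.
Proof.
move=> h; have S : Un_cv (fun k => inner (vsub (x k) l) (vsub (x k) l)) 0.
  apply: (Un_cv_sum (a := fun k i => vsub (x k) l i * vsub (x k) l i)) => i.
  have c0 : Un_cv (fun k => x k i - l i) 0.
    move=> eps e0; have [N HN] := h i eps e0; exists N => k kN.
    by have := HN k kN; rewrite /R_dist /Rdist Rminus_0_r.
  by have := CV_mult _ _ _ _ c0 c0; rewrite Rmult_0_l.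
move=> eps e0; have [N HN] := S (eps * eps) (Rmult_lt_0_compat _ _ e0 e0).
exists N => k kN; have := HN k kN.
rewrite /R_dist /Rdist !Rminus_0_r !Rabs_pos_eq; first exact/vnorm_lt_sq/Rlt_le.
  exact: vnorm_ge0.
exact: inner_ge0.
Qed.

(** Coordinates are treated one at a time, each passing to a further subsequence along which the
    earlier ones still converge. *)
Lemma bounded_vec_subseq {n} (x : nat -> vec n) B :
  (forall k, vnorm (x k) <= B) ->
  exists l (phi : nat -> nat),
    (forall k, (k <= phi k)%coq_nat) /\ vconv (fun k => x (phi k)) l.
Proof.
move=> xb.
suff [l [phi [h1 h2]]] : exists l (phi : nat -> nat), (forall k, (k <= phi k)%coq_nat) /\
    forall i : 'I_n, i \in enum 'I_n -> Un_cv (fun k => x (phi k) i) (l i).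
  exists l, phi; split=> //; apply: vconv_coord => i; apply: h2; exact: mem_enum.
elim: (enum 'I_n) => [|j s [l [phi [h1 h2]]]].
  by exists vzero, id; split.
have [k|a [psi [p1 p2]]] := @bounded_subseq (fun k => x (phi k) j) B.
  exact: Rle_trans (coord_le_vnorm _ _) (xb _).
exists (fun i => if i == j then a else l i), (fun k => phi (psi k)); split.
  by move=> k; have := h1 (psi k); have := p1 k; lia.
move=> i; rewrite inE; case: eqP => [->|_ /=] // is_.
exact: (Un_cv_subseq p1 (h2 i is_)).
Qed.

Lemma continuous_fun_cv {n} (h : vec n -> R) (x : nat -> vec n) l :
  continuous_fun h -> vconv x l -> Un_cv (fun k => h (x k)) (h l).
Proof.
move=> ch cx eps e0; have [d [d0 Hd]] := ch l eps e0.
have [N HN] := cx d d0; exists N => k kN; apply: Hd.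
have := HN k kN; rewrite /R_dist /Rdist Rminus_0_r Rabs_pos_eq //; exact: vnorm_ge0.
Qed.

Lemma Un_cv_le (u : nat -> R) l b : (forall k, u k <= b) -> Un_cv u l -> l <= b.
Proof.
move=> ub cu; apply: Rnot_lt_le => lt0.
have [N HN] := cu (l - b) ltac:(lra).
have := HN N (le_n N); have := ub N; rewrite /R_dist /Rdist; split_Rabs; lra.
Qed.

(** Weierstrass's theorem, through a minimizing sequence. Closedness and continuity are asked only
    along sequences in [S], because the later [psi] contains a power whose base is known to be
    positive only there. *)
Lemma min_attained {n} (S : vec n -> Prop) (psi : vec n -> R) B b x0 :
  S x0 -> (forall z, S z -> vnorm z <= B) -> (forall z, S z -> b <= psi z) ->
  (forall (z : nat -> vec n) l, (forall k, S (z k)) -> vconv z l ->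
     S l /\ Un_cv (fun k => psi (z k)) (psi l)) ->
  exists z, S z /\ forall y, S y -> psi z <= psi y.
Proof.
move=> S0 SB Sb Scl.
(* [- M] is the infimum of [psi] over [S]. *)
have [||M [M1 M2]] := completeness (fun r => exists z, S z /\ r = - psi z).
- by exists (- b) => r [z [Sz ->]]; have := Sb z Sz; lra.
- by exists (- psi x0), x0.
have E k : exists z, S z /\ psi z <= - M + / (INR k + 1).
  apply: NNPP => nE; have i0 := RinvN_pos k.
  suff : M <= M - / (INR k + 1) by lra.
  apply: M2 => r [z [Sz ->]]; apply: Rnot_lt_le => ?.
  apply: nE; exists z; split=> //; lra.
have [z Hz] := choice_fun E.
have [l [phi [h1 h2]]] := bounded_vec_subseq (fun k => SB _ (proj1 (Hz k))).
have [Sl cl] := Scl _ l (fun k => proj1 (Hz (phi k))) h2.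
exists l; split=> // y Sy.
apply: Rle_trans (_ : - M <= _); last first.
  by have := M1 (- psi y) (ex_intro _ y (conj Sy erefl)); lra.
have := CV_minus _ _ _ _ cl (Un_cv_subseq h1 Un_cv_inv_S).
rewrite Rminus_0_r; apply: Un_cv_le => k.
have := proj2 (Hz (phi k)); lra.
Qed.

Lemma ord_common_pos {m} (Q : 'I_m -> R -> Prop) :
  (forall i s s', 0 < s' <= s -> Q i s -> Q i s') ->
  (forall i, exists s, 0 < s /\ Q i s) -> exists s, 0 < s /\ forall i, Q i s.
Proof.
move=> mono ex.
suff [s [s0 hs]] : exists s, 0 < s /\ forall i, i \in enum 'I_m -> Q i s.
  by exists s; split=> // i; apply: hs; rewrite mem_enum.
elim: (enum 'I_m) => [|j l [s [s0 hs]]]; first by exists 1; split=> //; lra.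
have [s' [s'0 hs']] := ex j.
have mp : 0 < Rmin s s' by exact: Rmin_pos.
exists (Rmin s s'); split=> // i; rewrite inE => /orP[/eqP->|/hs].
  by apply: mono hs'; split=> //; exact: Rmin_r.
by apply: mono; split=> //; exact: Rmin_l.
Qed.

Lemma ord_common_bound {m} (b : 'I_m -> R) : exists M, 0 < M /\ forall i, b i <= M.
Proof.
have [i s s' [s0 s's] bs|i|s [s0 hs]] := @ord_common_pos m (fun i s => b i <= / s).
- exact: Rle_trans bs (Rinv_le_contravar _ _ s0 s's).
- have p : 0 < Rabs (b i) + 1 by have := Rabs_pos (b i); lra.
  exists (/ (Rabs (b i) + 1)); split; first exact: Rinv_0_lt_compat.
  by rewrite Rinv_inv; have := Rle_abs (b i); lra.
by exists (/ s); split=> //; exact: Rinv_0_lt_compat.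
Qed.

(** * Convexity, multipliers and the subproblem *)

(** Suppose the gap [eta] were positive. A short step [t] towards [y] has first-order error at most
    [t * eta / 2], while convexity caps the increase of [h] by [t * (h y - h x)]; the two are
    incompatible. *)
Lemma convex_grad_ineq {n} (h : vec n -> R) x v :
  convex_fun h -> has_grad h x v -> forall y, h x + inner v (vsub y x) <= h y.
Proof.
move=> ch gh y; apply: Rnot_lt_le => lt0.
set N := vnorm (vsub y x); have N0 : 0 <= N := vnorm_ge0 _.
set eta := h x + inner v (vsub y x) - h y; have eta0 : 0 < eta by rewrite /eta; lra.
have [d [d0 Hd]] := gh (eta / (2 * (N + 1))) ltac:(apply: Rdiv_lt_0_compat; lra).
set t := Rmin 1 (d / (2 * (N + 1))).
have t0 : 0 < t by apply: Rmin_pos; [lra | apply: Rdiv_lt_0_compat; lra].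
have t1 : t <= 1 := Rmin_l _ _.
have tN : t * N < d.
  have : t * (N + 1) <= d / (2 * (N + 1)) * (N + 1).
    by apply: Rmult_le_compat_r; [lra | exact: Rmin_r].
  have -> : d / (2 * (N + 1)) * (N + 1) = d / 2 by field; lra.
  nra.
have E : vsub (vadd (vscale t y) (vscale (1 - t) x)) x = vscale t (vsub y x) by vec_ring.
have := Hd (vadd (vscale t y) (vscale (1 - t) x)).
rewrite E vnorm_scale !innerE Rabs_pos_eq -/N; last lra.
move=> /(_ tN) h1; have h2 := ch y x t ltac:(lra).
have etaE : eta = h x + (inner v y - inner v x) - h y by rewrite /eta !innerE.
have e1 : eta / (2 * (N + 1)) * N <= eta / 2.
  have -> : eta / 2 = eta / (2 * (N + 1)) * (N + 1) by field; lra.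
  by apply: Rmult_le_compat_l; [apply: Rlt_le; apply: Rdiv_lt_0_compat; lra | lra].
have h3 : t * (inner v y - inner v x) - t * (eta / 2) <= t * (h y - h x).
  have : eta / (2 * (N + 1)) * (t * N) <= t * (eta / 2) by nra.
  move: h1; split_Rabs; lra.
have : inner v y - inner v x - eta / 2 <= h y - h x by nra.
lra.
Qed.

(* Convexity replaces the usual integration along the segment, at the price of
   a constant [L] instead of [L / 2]. *)
Lemma convex_descent {n} (h : vec n -> R) dh L :
  convex_fun h -> (forall x, has_grad h x (dh x)) -> lipschitz_map dh L ->
  forall x y, h y <= h x + inner (dh x) (vsub y x)
                     + Rabs L * inner (vsub y x) (vsub y x).
Proof.
move=> ch gh lh x y.
have h1 := convex_grad_ineq ch (gh y) x.
have h2 := cauchy_schwarz (vsub (dh y) (dh x)) (vsub y x).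
have h3 : vnorm (vsub (dh y) (dh x)) * vnorm (vsub y x)
          <= Rabs L * inner (vsub y x) (vsub y x).
  rewrite -vnorm_sq -Rmult_assoc; apply: Rmult_le_compat_r (vnorm_ge0 _) _.
  apply: Rle_trans (lh y x) _; apply: Rmult_le_compat_r (vnorm_ge0 _) (Rle_abs _).
by move: h1 h2 h3; rewrite !innerE; lra.
Qed.

(* Lagrange duality with a single constraint: the multiplier is a slope that
   separates the part of [S] with [s > 0] from the part with [s < 0]. *)
Lemma scalar_multiplier (S : R -> R -> Prop) s0 r0 :
  (forall s r s' r' t, 0 < t < 1 -> S s r -> S s' r' ->
     S (t * s + (1 - t) * s') (t * r + (1 - t) * r')) ->
  (forall s r, S s r -> s <= 0 -> 0 <= r) ->
  S s0 r0 -> s0 < 0 ->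
  exists lam, 0 <= lam <= r0 / (- s0) /\ forall s r, S s r -> 0 <= r + lam * s.
Proof.
move=> cS nS S0 s00.
(* The multiplier is the supremum of [E]; including 0 makes [E] nonempty and the multiplier
   nonnegative. *)
pose E q := q = 0 \/ exists s r, [/\ S s r, 0 < s & q = - r / s].
have UB s' r' : S s' r' -> s' < 0 -> forall q, E q -> q <= r' / (- s').
  move=> S' s'0 q [->|[s [r [Ss sp ->]]]].
    apply: Rmult_le_pos; first by apply: nS S' _; lra.
    by apply: Rlt_le; apply: Rinv_0_lt_compat; lra.
  (* With this weight the convex combination of the two points lands on [s = 0], where [nS]
     applies. *)
  have t01 : 0 < - s' / (s - s') < 1.
    split; first by apply: Rdiv_lt_0_compat; lra.
    by apply: (Rmult_lt_reg_r (s - s')); [lra | rewrite /Rdiv Rmult_assoc Rinv_l; lra].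
  have := nS _ _ (cS _ _ _ _ _ t01 Ss S').
  have -> : - s' / (s - s') * s + (1 - - s' / (s - s')) * s' = 0 by field; lra.
  have -> : - s' / (s - s') * r + (1 - - s' / (s - s')) * r'
            = (s * r' - s' * r) / (s - s') by field; lra.
  move=> /(_ (Rle_refl _)) h.
  have h2 : 0 <= s * r' - s' * r.
    have -> : s * r' - s' * r = (s * r' - s' * r) / (s - s') * (s - s') by field; lra.
    by apply: Rmult_le_pos => //; lra.
  apply: (Rmult_le_reg_r (s * - s')); first by nra.
  have -> : - r / s * (s * - s') = s' * r by field; lra.
  have -> : r' / - s' * (s * - s') = s * r' by field; lra.
  lra.
have [||lam [l1 l2]] := completeness E.
- by exists (r0 / - s0) => q; exact: UB.
- by exists 0; left.
exists lam; split.
  by split; [apply: l1; left | apply: l2 => q; exact: UB].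
move=> s r Ss; case: (Rtotal_order s 0) => [sn|[s_|sp]].
- have : lam <= r / (- s) by apply: l2 => q; exact: UB Ss sn q.
  move=> h; have : lam * (- s) <= r / (- s) * (- s) by apply: Rmult_le_compat_r; lra.
  have -> : r / (- s) * (- s) = r by field; lra.
  lra.
- by have := nS _ _ Ss; rewrite s_ => /(_ (Rle_refl _)); lra.
- have : - r / s <= lam by apply: l1; right; exists s, r.
  move=> h; have : - r / s * s <= lam * s by apply: Rmult_le_compat_r; lra.
  have -> : - r / s * s = - r by field; lra.
  lra.
Qed.

(** An equality because [Gbar] is quadratic in its moving point; the last term is the strong
    convexity that later gives growth around the subproblem solution. *)
Lemma Gbar_segment {n m} (g : 'I_m -> vec n -> R) dg xt Lg (y z : vec n) t i :
  Gbar g dg (vadd (vscale t z) (vscale (1 - t) y)) xt Lg i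
  = t * Gbar g dg z xt Lg i + (1 - t) * Gbar g dg y xt Lg i
    - Lg i / 2 * (t * (1 - t)) * inner (vsub z y) (vsub z y).
Proof.
by rewrite /Gbar !innerE (innerC xt z) (innerC xt y) (innerC z y); field.
Qed.

Lemma sub_obj_segment {n} df (P1 : vec n -> R) xt xi Lf (y z : vec n) t :
  convex_fun P1 -> 0 <= t <= 1 ->
  sub_obj df P1 xt xi Lf (vadd (vscale t z) (vscale (1 - t) y))
  <= t * sub_obj df P1 xt xi Lf z + (1 - t) * sub_obj df P1 xt xi Lf y
     - Lf / 2 * (t * (1 - t)) * inner (vsub z y) (vsub z y).
Proof.
move=> cP ht; have := cP z y t ht; rewrite /sub_obj => h.
by rewrite !innerE (innerC xt z) (innerC xt y) (innerC z y); lra.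
Qed.

(** Serves to let [t] tend to 0 once a strong convexity estimate on a segment has been divided by
    [t]. *)
Lemma le_of_scaled_le a b :
  (forall t, 0 < t < 1 -> (1 - t) * a <= b) -> a <= b.
Proof.
move=> h; apply: le_epsilon => eps e0.
have p : 0 < Rabs a + 1 by have := Rabs_pos a; lra.
set t := Rmin (1 / 2) (eps / (Rabs a + 1)).
have t0 : 0 < t by apply: Rmin_pos; [lra | apply: Rdiv_lt_0_compat; lra].
have t1 : t <= 1 / 2 := Rmin_l _ _.
have := h t ltac:(lra).
have : t * (Rabs a + 1) <= eps.
  have -> : eps = eps / (Rabs a + 1) * (Rabs a + 1) by field; lra.
  by apply: Rmult_le_compat_r; [lra | exact: Rmin_r].
have := Rle_abs a; nra.
Qed.

(* Dividing the [i]-th constraint by [Lg i] makes all of them strongly convex with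
   modulus 1, so that one multiplier serves for the whole system. *)
Lemma sub_sol_multiplier {n m} df (P1 : vec n -> R) (g : 'I_m -> vec n -> R) dg
    xt xi Lf Lg y z0 s0 :
  convex_fun P1 -> 0 <= Lf -> (forall i, 0 <= Lg i) ->
  sub_sol df P1 g dg xt xi Lf Lg y ->
  s0 < 0 -> (forall i, Gbar g dg z0 xt Lg i <= Lg i * s0) ->
  exists lam,
    0 <= lam <= (sub_obj df P1 xt xi Lf z0 - sub_obj df P1 xt xi Lf y) / (- s0) /\
    forall z s, (forall i, Gbar g dg z xt Lg i <= Lg i * s) ->
      sub_obj df P1 xt xi Lf y + (Lf + lam) / 2 * inner (vsub z y) (vsub z y)
      <= sub_obj df P1 xt xi Lf z + lam * s.
Proof.
move=> cP Lf0 Lg0 [feas opt] s00 z00.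
set obj := sub_obj df P1 xt xi Lf in opt *.
(* The convex set of pairs formed by a relaxation level [s] of the scaled constraints and an upper
   bound [r] on the excess objective attainable at that level. *)
pose S s r := exists z, (forall i, Gbar g dg z xt Lg i <= Lg i * s) /\ obj z - obj y <= r.
have [||||lam [l1 l2]] := @scalar_multiplier S s0 (obj z0 - obj y).
- move=> s r s' r' t t01 [z [z1 z2]] [z' [z'1 z'2]].
  exists (vadd (vscale t z) (vscale (1 - t) z')); split=> [i|].
    rewrite Gbar_segment.
    have : 0 <= Lg i / 2 * (t * (1 - t)) * inner (vsub z z') (vsub z z').
      apply: Rmult_le_pos (inner_ge0 _); apply: Rmult_le_pos; last by nra.
      by have := Lg0 i; lra.
    by have := z1 i; have := z'1 i; nra.
  have := @sub_obj_segment n df P1 xt xi Lf z' z t cP ltac:(lra); rewrite -/obj.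
  have : 0 <= Lf / 2 * (t * (1 - t)) * inner (vsub z z') (vsub z z').
    apply: Rmult_le_pos (inner_ge0 _); apply: Rmult_le_pos; nra.
  nra.
- move=> s r [z [z1 z2]] s_; suff : obj y <= obj z by lra.
  by apply: opt => i; have := z1 i; have := Lg0 i; nra.
- by exists z0; split=> //; lra.
- exact: s00.
exists lam; split=> // z s zs.
set N := inner (vsub z y) (vsub z y).
suff : (Lf + lam) / 2 * N <= obj z + lam * s - obj y by lra.
apply: le_of_scaled_le => t t01.
(* The multiplier inequality is used at the segment point [t z + (1 - t) y]: strong convexity lowers
   both its relaxation level and its objective by multiples of [t * (1 - t) * N]. *)
have := l2 (t * s - (t * (1 - t)) / 2 * N)
           (t * (obj z - obj y) - Lf / 2 * (t * (1 - t)) * N) => h.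
suff : 0 <= t * (obj z - obj y) - Lf / 2 * (t * (1 - t)) * N
         + lam * (t * s - t * (1 - t) / 2 * N) by nra.
apply: h; exists (vadd (vscale t z) (vscale (1 - t) y)); split=> [i|].
  rewrite Gbar_segment -/N; have := feas i; have := zs i; nra.
have := @sub_obj_segment n df P1 xt xi Lf y z t cP ltac:(lra); rewrite -/obj -/N; lra.
Qed.

(** The one-step inequality behind convergence and rates. The Slater point [xhat] bounds the
    multiplier by constants that do not depend on [xt], [y], [Lf] or [Lg]. *)
Lemma scp_subproblem_estimate {n m} (f P1 P2 : vec n -> R) df
    (g : 'I_m -> vec n -> R) dg K Lmin Mf Mg B delta sigma F0 Fb xhat xt xi y Lf Lg :
  convex_fun P1 -> convex_fun f -> (forall x, P2 x = 0) -> (forall i, xi i = 0) ->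
  (forall x z, f x + inner (df x) (vsub z x) <= f z) ->
  (forall x z, f z <= f x + inner (df x) (vsub z x) + K * inner (vsub z x) (vsub z x)) ->
  (forall i x z, g i x + inner (dg i x) (vsub z x) <= g i z) ->
  0 < Lmin -> 0 <= K -> 0 < delta -> 0 < sigma <= 1 -> sigma * (Mg * B) <= delta ->
  (forall i, g i xhat <= - delta) ->
  Lmin <= Lf <= Mf -> (forall i, Lmin <= Lg i <= Mg) -> 0 < Mg ->
  feasible g xt -> inner (vsub xhat xt) (vsub xhat xt) <= B ->
  inner (vsub y xt) (vsub y xt) <= B ->
  Fval f P1 P2 xt <= F0 -> Fval f P1 P2 xhat <= F0 -> Fb <= Fval f P1 P2 y ->
  sub_sol df P1 g dg xt xi Lf Lg y ->
  exists Lam,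
    Lmin <= Lam <= Mf + (F0 - Fb + Mf / 2 * B + K * B) * (2 * Mg) / (sigma * delta) /\
    forall z, feasible g z ->
      Fval f P1 P2 y <= Fval f P1 P2 z
        + Lam / 2 * (inner (vsub z xt) (vsub z xt) - inner (vsub z y) (vsub z y))
        + K * inner (vsub y xt) (vsub y xt).
Proof.
move=> cP cf P20 xi0 fl fu gl Lm K0 d0 s01 sB gh Lfb Lgb Mg0 fx Bh By Fx Fh Fy sol.
have B0 : 0 <= B by apply: Rle_trans (inner_ge0 _) By.
have objE z : sub_obj df P1 xt xi Lf z
    = inner (df xt) (vsub z xt) + Lf / 2 * inner (vsub z xt) (vsub z xt) + P1 z.
  rewrite /sub_obj; suff -> : vsub (df xt) xi = df xt by [].
  by apply: functional_extensionality => i; rewrite /vsub xi0; ring.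
(* Moving from [xt] towards [xhat] brings each linearized constraint below [- sigma * delta], while
   the choice of [sigma] keeps the quadratic term under [sigma * delta / 2]; half of the slack
   remains. *)
pose z0 := vadd (vscale sigma xhat) (vscale (1 - sigma) xt).
have z0E : vsub z0 xt = vscale sigma (vsub xhat xt) by rewrite /z0; vec_ring.
have ss0 : 0 < sigma * delta by nra.
have [||||lam [l1 l2]] := @sub_sol_multiplier n m df P1 g dg xt xi Lf Lg y z0
    (- (sigma * delta / (2 * Mg))) cP _ _ sol.
- lra.
- by move=> i; have := Lgb i; lra.
- have : 0 < sigma * delta / (2 * Mg) by apply: Rdiv_lt_0_compat; lra.
  lra.
- move=> i; rewrite /Gbar z0E.
  have h1 := gl i xt xhat; have h2 := gh i; have h3 := fx i; have h4 := Lgb i.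
  rewrite !inner_scaler !inner_scalel.
  have h5 : Lg i / 2 * (sigma * (sigma * inner (vsub xhat xt) (vsub xhat xt)))
            <= sigma * delta / 2.
    apply: Rle_trans (_ : sigma / 2 * (sigma * (Mg * B)) <= _); last by nra.
    have : Lg i * inner (vsub xhat xt) (vsub xhat xt) <= Mg * B.
      by apply: Rmult_le_compat => //; [lra | exact: inner_ge0 | lra].
    have : 0 <= sigma * sigma by nra.
    nra.
  have h6 : g i xt + sigma * inner (dg i xt) (vsub xhat xt) <= - (sigma * delta) by nra.
  suff : - (sigma * delta / 2) <= Lg i * - (sigma * delta / (2 * Mg)) by lra.
  have -> : - (sigma * delta / 2) = Mg * - (sigma * delta / (2 * Mg)) by field; lra.
  have : 0 < sigma * delta / (2 * Mg) by apply: Rdiv_lt_0_compat; lra.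
  nra.
rewrite /Fval in Fx Fh Fy.
have objb : sub_obj df P1 xt xi Lf z0 - sub_obj df P1 xt xi Lf y
            <= F0 - Fb + Mf / 2 * B + K * B.
  rewrite !objE.
  have := fl xt z0; have := fu xt y.
  have := cf xhat xt sigma ltac:(lra); have := cP xhat xt sigma ltac:(lra); rewrite -/z0.
  rewrite !P20 in Fx Fh Fy.
  have : Lf / 2 * inner (vsub z0 xt) (vsub z0 xt) <= Mf / 2 * B.
    apply: Rmult_le_compat; [lra | exact: inner_ge0 | lra |].
    rewrite z0E inner_scalel inner_scaler.
    have := inner_ge0 (vsub xhat xt).
    have : 0 <= sigma * sigma <= 1 by nra.
    nra.
  have : 0 <= Lf / 2 * inner (vsub y xt) (vsub y xt).
    by apply: Rmult_le_pos (inner_ge0 _); lra.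
  have : K * inner (vsub y xt) (vsub y xt) <= K * B by exact: Rmult_le_compat_l.
  nra.
(* The objective contributes the modulus [Lf] and the scaled constraints contribute [lam]. *)
exists (Lf + lam); split.
  split; first lra.
  apply: Rplus_le_compat; first lra.
  apply: Rle_trans (proj2 l1) _.
  rewrite Ropp_involutive.
  have -> : (F0 - Fb + Mf / 2 * B + K * B) * (2 * Mg) / (sigma * delta)
     = (F0 - Fb + Mf / 2 * B + K * B) / (sigma * delta / (2 * Mg)) by field; lra.
  apply: Rmult_le_compat_r => //; apply: Rlt_le; apply: Rinv_0_lt_compat.
  apply: Rdiv_lt_0_compat; lra.
move=> z fz.
(* By convexity the linearization of [g i] at [xt] is at most [g i z <= 0], so a feasible [z]
   violates [Gbar] by no more than its quadratic term. *)
have := l2 z (inner (vsub z xt) (vsub z xt) / 2).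
have H : forall i, Gbar g dg z xt Lg i <= Lg i * (inner (vsub z xt) (vsub z xt) / 2).
  by move=> i; rewrite /Gbar; have := gl i xt z; have := fz i; lra.
move=> /(_ H); rewrite !objE /Fval !P20.
have := fu xt y; have := fl xt z.
have : 0 <= Lf / 2 * inner (vsub y xt) (vsub y xt).
  by apply: Rmult_le_pos (inner_ge0 _); lra.
lra.
Qed.

(** * Accepted line-search parameters, Slater points and cluster points *)

Lemma cauchy_schwarz_abs {n} (u v : vec n) : Rabs (inner u v) <= vnorm u * vnorm v.
Proof.
have h1 := cauchy_schwarz u v; have := cauchy_schwarz (vscale (-1) u) v.
rewrite inner_scalel vnorm_scale Rabs_Ropp Rabs_R1; split_Rabs; lra.
Qed.

Lemma has_grad_continuous {n} (h : vec n -> R) dh :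
  (forall x, has_grad h x (dh x)) -> continuous_fun h.
Proof.
move=> gh x eps e0; have [d [d0 Hd]] := gh x 1 Rlt_0_1.
have n0 := vnorm_ge0 (dh x).
have p : 0 < eps / (vnorm (dh x) + 2) by apply: Rdiv_lt_0_compat; lra.
exists (Rmin d (eps / (vnorm (dh x) + 2))); split; first exact: Rmin_pos.
move=> y hy.
have h1 := Hd y (Rlt_le_trans _ _ _ hy (Rmin_l _ _)).
have h2 := cauchy_schwarz_abs (dh x) (vsub y x).
have h3 : vnorm (vsub y x) < eps / (vnorm (dh x) + 2).
  exact: Rlt_le_trans hy (Rmin_r _ _).
have h4 : (vnorm (dh x) + 2) * vnorm (vsub y x) < eps.
  have -> : eps = (vnorm (dh x) + 2) * (eps / (vnorm (dh x) + 2)) by field; lra.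
  by apply: Rmult_lt_compat_l; lra.
have := vnorm_ge0 (vsub y x).
move: h1 h2; split_Rabs; nra.
Qed.

(** A nonzero Frechet subgradient of the zero function is refuted by a short step in its own
    direction, with tolerance half its norm; limits of zero vectors are zero. *)
Lemma limiting_sub_zero_fun {n} (h : vec n -> R) x xi :
  (forall y, h y = 0) -> limiting_sub (fun _ => True) h x xi -> forall i, xi i = 0.
Proof.
move=> h0 [_ [xk [vk [Fk [_ [_ cv]]]]]].
have vk0 k : vnorm (vk k) = 0.
  have [_ Fe] := Fk k; have n0 := vnorm_ge0 (vk k).
  apply: Rle_antisym => //; apply: Rnot_lt_le => lt0.
  have [d [d0 Hd]] := Fe (vnorm (vk k) / 2) ltac:(lra).
  pose t := d / (2 * vnorm (vk k)).
  have t0 : 0 < t by apply: Rdiv_lt_0_compat; lra.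
  have E : vsub (vadd (xk k) (vscale t (vk k))) (xk k) = vscale t (vk k) by vec_ring.
  have := Hd (vadd (xk k) (vscale t (vk k))) I.
  rewrite E vnorm_scale Rabs_pos_eq; last lra.
  have tn : t * vnorm (vk k) = d / 2 by rewrite /t; field; lra.
  rewrite tn !h0 inner_scaler -vnorm_sq -Rmult_assoc tn => /(_ ltac:(lra)).
  have := Rmult_lt_0_compat _ _ d0 lt0; lra.
move=> i; apply: Rminus_diag_uniq; rewrite Rminus_0_r.
have : vnorm xi <= 0.
  apply: Rnot_lt_le => lt0; have [N HN] := cv _ lt0; have := HN N (le_n N).
  rewrite /R_dist /Rdist Rminus_0_r Rabs_pos_eq; last exact: vnorm_ge0.
  have := vnorm_le_add xi (vk N); rewrite vk0 vnorm_subC; lra.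
have := coord_le_vnorm xi i; split_Rabs; lra.
Qed.

(** A trial is feasible once every [Lg i >= 2 * Kg], and a feasible trial is accepted once
    [Lf >= 2 * K + c]. A parameter is thus multiplied by [tau] only below its threshold. *)
Lemma scp_step_parameters {n m} (f P1 P2 : vec n -> R) df (g : 'I_m -> vec n -> R) dg
    c Lmin Lmax tau K Kg xt y :
  (forall x, P2 x = 0) ->
  (forall x z, f z <= f x + inner (df x) (vsub z x) + K * inner (vsub z x) (vsub z x)) ->
  (forall i x z, g i z <= g i x + inner (dg i x) (vsub z x)
                          + Kg * inner (vsub z x) (vsub z x)) ->
  0 <= K -> 0 < Kg -> 0 < c -> 0 < Lmin < Lmax -> 1 < tau -> feasible g xt ->
  SCP_step f P1 P2 df g dg c Lmin Lmax tau xt y ->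
  exists xi Lf Lg, (forall i, xi i = 0) /\
    Lmin <= Lf <= Lmax + tau * (2 * K + c) /\
    (forall i, Lmin <= Lg i <= (1 + tau * (2 * Kg / Lmin)) * Lmax) /\
    sub_sol df P1 g dg xt xi Lf Lg y /\ accept f P1 P2 g c xt y.
Proof.
move=> P20 fu gu K0 Kg0 c0 HL tau1 fx [xi [sxi [N [Lf [Lg [xs]]]]]].
move=> [Lf0 [Lg0 [sol [upd [acc ->]]]]].
have xi0 := limiting_sub_zero_fun P20 sxi.
have q0 : 0 < 2 * Kg / Lmin by apply: Rdiv_lt_0_compat; lra.
(* All components of [Lg] share one growth factor [r]; [r >= 2 * Kg / Lmin] puts each of them above
   [2 * Kg]. *)
suff inv k : (k <= N)%N -> Lmin <= Lf k <= Lmax + tau * (2 * K + c) /\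
    exists r, 1 <= r <= 1 + tau * (2 * Kg / Lmin) /\ forall i, Lg k i = r * Lg O i.
  exists xi, (Lf N), (Lg N); have [h1 [r [hr hL]]] := inv N (leqnn N).
  split=> //; split=> //; split; last by split=> //; exact: sol.
  move=> i; rewrite hL; have := Lg0 i => ?; split; first by nra.
  by apply: Rmult_le_compat; lra.
elim: k => [_|k IH kN].
  split; first by nra.
  by exists 1; split=> [|i]; [nra | lra].
have [hf [r [hr hL]]] := IH (ltnW kN).
have [nacc upd_k] := upd k kN; have [sfeas sopt] := sol k (ltnW kN).
case: upd_k => [[nf [-> ->]]|[fk [-> ->]]].
  split=> //; exists (tau * r); split; last by move=> i; rewrite hL; ring.
  suff : r < 2 * Kg / Lmin by nra.
  apply: Rnot_le_lt => rK; apply: nf => i.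
  apply: Rle_trans (gu i xt _) (Rle_trans _ _ _ _ (sfeas i)); rewrite /Gbar.
  have -> : Kg * inner (vsub (xs k) xt) (vsub (xs k) xt)
            = 2 * Kg / 2 * inner (vsub (xs k) xt) (vsub (xs k) xt) by field.
  suff : 2 * Kg <= Lg k i by have := inner_ge0 (vsub (xs k) xt); nra.
  rewrite hL; have -> : 2 * Kg = 2 * Kg / Lmin * Lmin by field; lra.
  by apply: Rmult_le_compat; try lra; have := Lg0 i; lra.
split; last by exists r.
suff : Lf k < 2 * K + c by nra.
apply: Rnot_le_lt => LK; apply: nacc; split=> //.
(* [xt] is admissible in its own subproblem; comparing the trial point with it gives the
   decrease. *)
have Gx i : Gbar g dg xt xt (Lg k) i <= 0.
  by rewrite /Gbar !innerE; have := fx i; lra.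
have := sopt xt Gx; rewrite /sub_obj.
have -> : vsub (df xt) xi = df xt.
  by apply: functional_extensionality => i; rewrite /vsub xi0; ring.
have := fu xt (xs k); rewrite /Fval !P20.
have -> : vsub xt xt = vzero by vec_ring.
have -> : @inner n vzero vzero = 0.
  by have -> : @vzero n = vscale 0 xt; [vec_ring | rewrite inner_scalel; ring].
have -> : inner (df xt) vzero = 0.
  by have -> : @vzero n = vscale 0 xt; [vec_ring | rewrite inner_scaler; ring].
have := inner_ge0 (vsub (xs k) xt); nra.
Qed.

(** A short move along the MFCQ direction keeps inactive constraints negative by continuity and
    makes active ones negative to first order. *)
Lemma slater_point {n m} (g : 'I_m -> vec n -> R) dg x0 :
  (forall i x, has_grad (g i) x (dg i x)) -> (forall i, continuous_fun (g i)) ->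
  (forall i, convex_fun (g i)) -> feasible g x0 ->
  (exists d, forall i, g i x0 = 0 -> inner (dg i x0) d < 0) ->
  exists xhat delta, 0 < delta /\ forall i, g i xhat <= - delta.
Proof.
move=> gg cg vg f0 [d hd].
have [i s s' hs Q|i|s [s0 Hs]] := @ord_common_pos m
    (fun i s => forall t, 0 < t <= s -> g i (vadd x0 (vscale t d)) < 0).
- by move=> t ht; apply: Q; lra.
- have E t : vsub (vadd x0 (vscale t d)) x0 = vscale t d by vec_ring.
  have n0 := vnorm_ge0 d.
  have small r : 0 < r -> exists s, 0 < s /\
      forall t, 0 < t <= s -> vnorm (vsub (vadd x0 (vscale t d)) x0) < r.
    move=> r0; exists (r / (vnorm d + 1)); split; first by apply: Rdiv_lt_0_compat; lra.
    move=> t ht; rewrite E vnorm_scale Rabs_pos_eq; last lra.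
    have : t * (vnorm d + 1) <= r.
      have -> : r = r / (vnorm d + 1) * (vnorm d + 1) by field; lra.
      by apply: Rmult_le_compat_r; lra.
    nra.
  case: (f0 i) => [neg|act].
    have [r [r0 Hr]] := cg i x0 (- g i x0) ltac:(lra).
    have [s [s0 Hs]] := small r r0; exists s; split=> // t ht.
    by have := Hr _ (Hs t ht); split_Rabs; lra.
  have neg := hd i act.
  have [r [r0 Hr]] := gg i x0 (- inner (dg i x0) d / (2 * (vnorm d + 1)))
    ltac:(apply: Rdiv_lt_0_compat; lra).
  have [s [s0 Hs]] := small r r0; exists s; split=> // t ht.
  have := Hr _ (Hs t ht); rewrite E inner_scaler vnorm_scale act (Rabs_pos_eq t); last lra.
  set I := inner _ _ in neg *.
  have : - I / (2 * (vnorm d + 1)) * (t * vnorm d) <= t * (- I / 2).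
    have -> : t * (- I / 2) = - I / (2 * (vnorm d + 1)) * (t * (vnorm d + 1)) by field; lra.
    apply: Rmult_le_compat_l; last by nra.
    by apply: Rlt_le; apply: Rdiv_lt_0_compat; lra.
  split_Rabs; nra.
have [i a a' ha Q|i|delta [d0 Hd]] := @ord_common_pos m
    (fun i a => g i (vadd x0 (vscale s d)) <= - a).
- lra.
- by exists (- g i (vadd x0 (vscale s d))); have := Hs i s ltac:(lra); lra.
by exists (vadd x0 (vscale s d)), delta.
Qed.

Lemma decreasing_cluster {n} (D : vec n -> Prop) (F : vec n -> R) (x : nat -> vec n) :
  (forall (z : nat -> vec n) l, (forall k, D (z k)) -> vconv z l -> D l) ->
  continuous_fun F -> level_bounded D F -> (forall t, D (x t)) ->
  (forall t, F (x (S t)) <= F (x t)) ->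
  exists xbar (phi : nat -> nat), D xbar /\ (forall t, F xbar <= F (x t)) /\
    (forall k, (k <= phi k)%coq_nat) /\ vconv (fun k => x (phi k)) xbar.
Proof.
move=> Dcl cF lb Dx dF.
have dec s t : (s <= t)%coq_nat -> F (x t) <= F (x s).
  by elim=> [|t' _ IH]; [lra | have := dF t'; lra].
have [B HB] := lb (F (x O)).
have [l [phi [h1 h2]]] :=
  bounded_vec_subseq (fun t => HB _ (Dx t) (dec O t (le_0_n t))).
exists l, phi; split; first exact: (Dcl _ _ (fun k => Dx (phi k)) h2).
split=> // t.
have := continuous_fun_cv cF h2.
(* The shift by [t] leaves only indices at least [t], where monotonicity bounds the values by
   [F (x t)]. *)
move=> /(@Un_cv_subseq _ _ (fun k => (k + t)%coq_nat)) h.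
apply: (Un_cv_le _ (h _)) => k; last by lia.
by apply: dec; have := h1 (k + t)%coq_nat; lia.
Qed.

(** * From the KL inequality to an error bound *)

Lemma Rpower_gt0 a b : 0 < Rpower a b.
Proof. exact: exp_pos. Qed.

Lemma Rpower_le_exponent e a b : 0 < e <= 1 -> a <= b -> Rpower e b <= Rpower e a.
Proof.
move=> e01 ab; rewrite /Rpower; have l0 : ln e <= 0.
  rewrite -ln_1; case: (Req_dec e 1) => [->|ne]; first lra.
  by apply/Rlt_le/ln_increasing; lra.
have : b * ln e <= a * ln e by nra.
by case=> [h|->]; [exact/Rlt_le/exp_increasing | lra].
Qed.

Lemma ln_le_sub1 u : 0 < u -> ln u <= u - 1.
Proof. by move=> u0; have := exp_ineq1_le (ln u); rewrite exp_ln //; lra. Qed.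

(** Concavity of [s ^ th]. With [u = b / a] it reads [u ^ th <= th * u + (1 - th)], which follows by
    weighting [ln s <= s - 1] at [u / w] and [1 / w]. *)
Lemma Rpower_tangent a b th : 0 < a -> 0 < b -> 0 < th <= 1 ->
  Rpower b th <= Rpower a th + th * Rpower a (th - 1) * (b - a).
Proof.
move=> a0 b0 th01.
have ia : 0 < / a := Rinv_0_lt_compat _ a0.
pose u := b / a; have u0 : 0 < u by apply: Rmult_lt_0_compat.
pose w := th * u + (1 - th).
have w0 : 0 < w by rewrite /w; nra.
have iw : 0 < / w := Rinv_0_lt_compat _ w0.
have h1 : th * ln u <= ln w.
  have := ln_le_sub1 (Rmult_lt_0_compat _ _ u0 iw); have := ln_le_sub1 iw.
  rewrite ln_mult // ln_Rinv // => A B.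
  have : th * (u * / w - 1) + (1 - th) * (/ w - 1) = 0 by rewrite /w; field; rewrite -/w; lra.
  nra.
have h2 : Rpower u th <= w.
  rewrite /Rpower -[X in _ <= X](exp_ln w) //.
  by case: h1 => [h|->]; [exact/Rlt_le/exp_increasing | lra].
have -> : b = u * a by rewrite /u; field; lra.
rewrite -Rpower_mult_distr //.
have -> : Rpower a (th - 1) = Rpower a th * / a.
  by rewrite Rpower_plus Rpower_Ropp Rpower_1.
have -> : Rpower a th + th * (Rpower a th * / a) * (u * a - a) = w * Rpower a th.
  by rewrite /w; field; lra.
by apply: Rmult_le_compat_r h2; exact/Rlt_le/Rpower_gt0.
Qed.

(** Gaps are restricted to values below 1, where a larger exponent weakens the inequality. This
    reduces every exponent up to 1/2 to 1/2. *)
Lemma KL_at_exponent_mono {n} (D : vec n -> Prop) (F : vec n -> R) al be xh :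
  al <= be < 1 -> KL_at D F al xh -> KL_at D F be xh.
Proof.
move=> ab [a [r [a0 [ha [r0 [a00 H]]]]]].
exists (Some (match a with None => 1 | Some s => Rmin s 1 end)), r,
  (a0 * (1 - al) / (1 - be)).
have le1 z : below_ext z (Some (match a with None => 1 | Some s => Rmin s 1 end)) ->
    below_ext z a /\ z < 1.
  case: a ha {H} => [s|] /= _ hz; last by split.
  by have := Rmin_l s 1; have := Rmin_r s 1; lra.
split; first by case: a ha {H le1} => [s|] /= ?; [apply: Rmin_pos; lra | lra].
split=> //; split; first by apply: Rdiv_lt_0_compat; nra.
move=> x Dx hx Fx /le1[b1 b2] v hv.
apply: Rle_trans (H x Dx hx Fx b1 v hv) _.
have -> : a0 * (1 - al) / (1 - be) * (1 - be) = a0 * (1 - al) by field; lra.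
apply: Rmult_le_compat_r (vnorm_ge0 _) _.
apply: Rmult_le_compat_l; first by nra.
by apply: Rpower_le_exponent; lra.
Qed.

(* The perturbation is smooth, so no subdifferential sum rule is needed: the
   subgradient comes from the tangent inequality for [s ^ (1 - al)]. *)
Lemma frechet_sub_of_prox {n} (D : vec n -> Prop) (F : vec n -> R) (Fb al ka r : R) x z :
  0 <= al < 1 -> 0 < ka -> 0 < r -> D z -> Fb < F z ->
  (forall y, D y -> vnorm (vsub y z) < r -> Fb < F y /\
     Rpower (F z - Fb) (1 - al) + ka / 2 * inner (vsub z x) (vsub z x)
     <= Rpower (F y - Fb) (1 - al) + ka / 2 * inner (vsub y x) (vsub y x)) ->
  frechet_sub D F z
    (vscale (ka / ((1 - al) * Rpower (F z - Fb) (- al))) (vsub x z)).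
Proof.
move=> al01 ka0 r0 Dz Fz opt; split=> // eps e0.
set w := (1 - al) * Rpower (F z - Fb) (- al).
have w0 : 0 < w by apply: Rmult_lt_0_compat; [lra | exact: Rpower_gt0].
(* Within this radius the quadratic remainder [ka / 2 * N^2] is absorbed by [w * eps * N]. *)
exists (Rmin r (eps * (2 * w / ka))); split.
  apply: Rmin_pos => //; apply: Rmult_lt_0_compat => //.
  by apply: Rdiv_lt_0_compat; lra.
move=> y Dy hy.
have [Fy h] := opt y Dy (Rlt_le_trans _ _ _ hy (Rmin_l _ _)).
have tg := @Rpower_tangent (F z - Fb) (F y - Fb) (1 - al) ltac:(lra) ltac:(lra) ltac:(lra).
have E1 : 1 - al - 1 = - al by ring.
rewrite E1 -/w in tg.
have N0 := vnorm_ge0 (vsub y z).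
set N := vnorm (vsub y z) in hy N0 *.
have NE : inner (vsub y x) (vsub y x)
          = inner (vsub z x) (vsub z x) - 2 * inner (vsub x z) (vsub y z) + N * N.
  by rewrite /N vnorm_sq !innerE (innerC x z) (innerC x y) (innerC z y); ring.
rewrite NE in h; rewrite inner_scalel.
have h2 : ka * inner (vsub x z) (vsub y z) - ka / 2 * (N * N) <= w * (F y - F z) by lra.
have h3 : ka / 2 * N <= w * eps.
  have : N <= eps * (2 * w / ka) by apply: Rlt_le; exact: Rlt_le_trans hy (Rmin_r _ _).
  move=> h3; have -> : w * eps = ka / 2 * (eps * (2 * w / ka)) by field; lra.
  by apply: Rmult_le_compat_l; lra.
apply: (Rmult_le_reg_l w) => //.
have -> : w * (F z + ka / w * inner (vsub x z) (vsub y z) - eps * N)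
   = w * F z + ka * inner (vsub x z) (vsub y z) - w * eps * N by field; lra.
have : ka / 2 * N * N <= w * eps * N by apply: Rmult_le_compat_r.
lra.
Qed.

Lemma Un_cv_const a : Un_cv (fun _ => a) a.
Proof.
move=> e e0; exists O => k _.
by rewrite /R_dist /Rdist (_ : a - a = 0) ?Rabs_R0 //; ring.
Qed.

Lemma vconv_const {n} (u : vec n) : vconv (fun _ => u) u.
Proof. by rewrite /vconv vnorm_subxx; exact: Un_cv_const. Qed.

Lemma frechet_limiting {n} (D : vec n -> Prop) F (x v : vec n) :
  frechet_sub D F x v -> limiting_sub D F x v.
Proof.
move=> h; split; first by case: h.
exists (fun _ => x), (fun _ => v); split=> //; split; first exact: vconv_const.
by split; [exact: Un_cv_const | exact: vconv_const].
Qed.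

Lemma vnorm_sub_cv {n} (z : nat -> vec n) l x :
  vconv z l -> Un_cv (fun k => vnorm (vsub (z k) x)) (vnorm (vsub l x)).
Proof.
move=> cv; apply: (Un_cv_bounded_dist _ cv) => k.
have := vnorm_triangle l (z k) x; have := vnorm_triangle (z k) l x.
rewrite (vnorm_subC l (z k)); split_Rabs; lra.
Qed.

(** If [F] stayed above [F xbar] on the part of [D] within [rho] of [x], the penalized power [psi]
    would have a minimizer [z] there. Comparison with [x] puts [z] close to [x], whereas KL at [z]
    forces it far away. *)
Lemma KL_error_bound {n} (D : vec n -> Prop) (F : vec n -> R) al xbar :
  0 <= al < 1 -> continuous_fun F ->
  (forall (z : nat -> vec n) l, (forall k, D (z k)) -> vconv z l -> D l) ->
  KL_at D F al xbar ->
  exists r eta A, 0 < r /\ 0 < eta /\ 0 < A /\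
    forall x, D x -> vnorm (vsub x xbar) < r -> F xbar < F x < F xbar + eta ->
      exists p, D p /\ F p <= F xbar /\
        vnorm (vsub x p) <= A * Rpower (F x - F xbar) (1 - al).
Proof.
move=> al01 cF Dcl [a [r [a0 [ha [r0 [a00 KL]]]]]].
set Fb := F xbar in KL *.
pose a1 := match a with None => 1 | Some s => s end.
have a10 : 0 < a1 by rewrite /a1; case: a ha {KL a1} => //= ?; lra.
have below s : s < a1 -> below_ext s a by rewrite /a1; case: a {KL ha a1 a10} => //=.
(* Chosen so that [3 * a0 * w = r / 2]: the ball of radius [rho] around [x] then stays in the KL
   neighborhood. *)
pose w := r / (6 * a0); have w0 : 0 < w by apply: Rdiv_lt_0_compat; lra.
exists (r / 2), (Rmin a1 (Rpower w (/ (1 - al)))), (3 * a0).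
split; first lra.
split; first by apply: Rmin_pos => //; exact: Rpower_gt0.
split; first lra.
move=> x Dx hx [Fx1 Fx2].
set Phi := Rpower (F x - Fb) (1 - al).
have P0 : 0 < Phi := Rpower_gt0 _ _.
have e1 : F x - Fb < a1 by have := Rmin_l a1 (Rpower w (/ (1 - al))); lra.
have Pw : Phi <= w.
  have -> : w = Rpower (Rpower w (/ (1 - al))) (1 - al).
    by rewrite Rpower_mult Rinv_l ?Rpower_1 //; lra.
  by apply: Rle_Rpower_l; [lra | have := Rmin_r a1 (Rpower w (/ (1 - al))); lra].
set rho := 3 * a0 * Phi; have rho0 : 0 < rho by rewrite /rho; nra.
have rhor : rho <= r / 2.
  have -> : r / 2 = 3 * a0 * w by rewrite /w; field; lra.
  by apply: Rmult_le_compat_l; lra.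
apply: NNPP => none.
have pos z : D z -> vnorm (vsub x z) <= rho -> Fb < F z.
  by move=> Dz hz; apply: Rnot_le_lt => le; apply: none; exists z.
(* With this weight minimality gives [N^2 <= 8 * (a0 * Phi)^2], hence [N < 3 * a0 * Phi = rho],
   while KL gives [N >= 4 * a0 * Phi]. *)
pose ka := / (4 * a0 * a0 * Phi).
have den0 : 0 < 4 * a0 * a0 * Phi.
  by apply: Rmult_lt_0_compat => //; apply: Rmult_lt_0_compat => //; lra.
have ka0 : 0 < ka by exact: Rinv_0_lt_compat.
pose psi z := Rpower (F z - Fb) (1 - al) + ka / 2 * inner (vsub z x) (vsub z x).
have [||||z [[Dz hz] zmin]] := @min_attained n
   (fun z => D z /\ vnorm (vsub z x) <= rho) psi (rho + vnorm x) 0 x.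
- by split=> //; rewrite vnorm_subxx; lra.
- by move=> z [_ hz]; have := vnorm_le_add z x; lra.
- move=> z _; rewrite /psi; have := Rpower_gt0 (F z - Fb) (1 - al).
  have := inner_ge0 (vsub z x); nra.
- move=> z l hz cv.
  have cn := vnorm_sub_cv x cv.
  have Dl : D l by apply: Dcl cv => k; have [] := hz k.
  have nl : vnorm (vsub l x) <= rho by apply: Un_cv_le cn => k; have [] := hz k.
  split=> //.
  have cF' : Un_cv (fun k => F (z k) - Fb) (F l - Fb).
    exact: CV_minus (continuous_fun_cv cF cv) (Un_cv_const Fb).
  have lpos : 0 < F l - Fb by have := pos l Dl; rewrite vnorm_subC => /(_ nl); lra.
  have cP : continuity_pt (fun s => Rpower s (1 - al)) (F l - Fb).
    apply: derivable_continuous_pt.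
    by exists ((1 - al) * Rpower (F l - Fb) (1 - al - 1)); exact: derivable_pt_lim_power.
  rewrite /psi -vnorm_sq.
  under [X in Un_cv X _]functional_extensionality => k do rewrite -vnorm_sq.
  apply: CV_plus; first exact: (continuity_seq _ _ _ cP cF').
  apply: (CV_mult _ _ _ _ (Un_cv_const (ka / 2))); exact: CV_mult.
have xx : vnorm (vsub x x) <= rho by rewrite vnorm_subxx; lra.
have zx := zmin x (conj Dx xx).
have Fz : Fb < F z by apply: pos => //; rewrite vnorm_subC.
rewrite /psi (_ : inner (vsub x x) (vsub x x) = 0) in zx; last first.
  by rewrite -vnorm_sq vnorm_subxx; ring.
rewrite Rmult_0_r Rplus_0_r -/Phi in zx.
have Nn := vnorm_ge0 (vsub z x).
set N := vnorm (vsub z x) in hz Nn; rewrite -vnorm_sq -/N in zx.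
have pz := Rpower_gt0 (F z - Fb) (1 - al).
have kaE : 4 * a0 * a0 * Phi * ka = 1 by rewrite /ka Rinv_r; lra.
have N8 : N * N <= 8 * (a0 * Phi) * (a0 * Phi).
  have : ka / 2 * (N * N) <= Phi by lra.
  have -> : N * N = 8 * a0 * a0 * Phi * (ka / 2 * (N * N)).
    have -> : 8 * a0 * a0 * Phi * (ka / 2 * (N * N))
            = (4 * a0 * a0 * Phi * ka) * (N * N) by field.
    by rewrite kaE; ring.
  move=> h; have -> : 8 * (a0 * Phi) * (a0 * Phi) = 8 * a0 * a0 * Phi * Phi by ring.
  by apply: Rmult_le_compat_l => //; lra.
have aP : 0 < a0 * Phi by exact: Rmult_lt_0_compat.
have Nrho : N < rho by rewrite /rho; nra.
have Fzx : F z - Fb <= F x - Fb.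
  apply: Rnot_lt_le => lt1.
  have := @Rlt_Rpower_l (F x - Fb) (F z - Fb) (1 - al) ltac:(lra) ltac:(lra).
  rewrite -/Phi; have : 0 <= ka / 2 * (N * N) by nra.
  lra.
have sub : frechet_sub D F z
    (vscale (ka / ((1 - al) * Rpower (F z - Fb) (- al))) (vsub x z)).
  (* Since [N < rho], a ball of radius [rho - N] around [z] lies in the region of minimization, so
     [z] is an unconstrained local minimizer on [D]. *)
  apply: (@frechet_sub_of_prox _ _ _ _ _ _ (rho - N)) => //; first lra.
  move=> y Dy hy.
  have yx : vnorm (vsub y x) <= rho by have := vnorm_triangle z y x; rewrite -/N; lra.
  split; last exact: zmin.
  by apply: pos => //; rewrite vnorm_subC.
have zb : vnorm (vsub z xbar) < r by have := vnorm_triangle x z xbar; rewrite -/N; lra.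
have := KL z Dz zb Fz (below _ (Rle_lt_trans _ _ _ Fzx e1)) _ (frechet_limiting sub).
rewrite vnorm_scale (vnorm_subC x z) -/N.
have wp := Rpower_gt0 (F z - Fb) (- al).
rewrite Rabs_pos_eq; last first.
  by apply: Rlt_le; apply: Rdiv_lt_0_compat => //; apply: Rmult_lt_0_compat; lra.
have -> : a0 * (1 - al) * Rpower (F z - Fb) (- al) *
   (ka / ((1 - al) * Rpower (F z - Fb) (- al)) * N) = a0 * ka * N.
  by field; split; lra.
move=> h; have : 4 * (a0 * Phi) <= N.
  have : 4 * a0 * Phi * 1 <= 4 * a0 * Phi * (a0 * ka * N).
    by apply: Rmult_le_compat_l h; nra.
  have -> : 4 * a0 * Phi * (a0 * ka * N) = (4 * a0 * a0 * Phi * ka) * N by ring.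
  rewrite kaE; lra.
rewrite /rho in Nrho; lra.
Qed.

(** * Recursive inequalities *)

Lemma linear_rate (e : nat -> R) C T :
  0 < C -> (forall t, (T <= t)%coq_nat -> e (S t) <= C * (e t - e (S t))) ->
  forall k, e (T + k)%coq_nat <= e T * (C / (1 + C)) ^ k.
Proof.
move=> C0 h; elim=> [|k IH]; first by rewrite -plus_n_O /=; lra.
have q0 : 0 < C / (1 + C) by apply: Rdiv_lt_0_compat; lra.
rewrite -plus_n_Sm.
have := h (T + k)%coq_nat ltac:(lia) => hk.
apply: Rle_trans (_ : C / (1 + C) * e (T + k)%coq_nat <= _).
  apply: (Rmult_le_reg_l (1 + C)); first lra.
  have -> : (1 + C) * (C / (1 + C) * e (T + k)%coq_nat) = C * e (T + k)%coq_nat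
    by field; lra.
  lra.
apply: Rle_trans (Rmult_le_compat_l _ _ _ (Rlt_le _ _ q0) IH) _ => /=.
by apply: Req_le; ring.
Qed.

(** The recursion says [v >= u * (1 + w)] with [w = u ^ be / C]; a Bernoulli-type bound on
    [(1 + w) ^ be] then makes the power [- be] grow by a fixed amount per step. *)
Lemma sublinear_step u v be C :
  0 < be -> 0 < C -> 0 < u <= 1 -> Rpower u (1 + be) <= C * (v - u) ->
  Rpower v (- be) + be / (C + 1 + be) <= Rpower u (- be).
Proof.
move=> be0 C0 u01 h.
have a0 : 0 < Rpower u be := Rpower_gt0 _ _.
have a1 : Rpower u be <= 1.
  by rewrite -[X in _ <= X](Rpower_O u); [apply: Rpower_le_exponent; lra | lra].
rewrite Rpower_plus Rpower_1 in h; last lra.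
set a := Rpower u be in h a0 a1.
pose w := a / C; have w0 : 0 < w by exact: Rdiv_lt_0_compat.
have wv : u * (1 + w) <= v.
  apply: (Rmult_le_reg_l C) => //.
  have -> : C * (u * (1 + w)) = C * u + u * a by rewrite /w; field; lra.
  lra.
have bern : 1 + be * (w / (1 + w)) <= Rpower (1 + w) be.
  apply: Rle_trans (exp_ineq1_le _).
  apply: Rplus_le_compat_l; apply: Rmult_le_compat_l; first lra.
  have := ln_le_sub1 (Rinv_0_lt_compat (1 + w) ltac:(lra)); rewrite ln_Rinv; last lra.
  have -> : w / (1 + w) = 1 - / (1 + w) by field; lra.
  lra.
have bv : a * (1 + be * (w / (1 + w))) <= Rpower v be.
  apply: Rle_trans (_ : Rpower (u * (1 + w)) be <= _).
    by rewrite -Rpower_mult_distr -/a; [apply: Rmult_le_compat_l; lra | lra | lra].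
  by apply: Rle_Rpower_l; [lra | nra].
rewrite !Rpower_Ropp -/a.
have p : 0 < 1 + be * (w / (1 + w)).
  have : 0 < w / (1 + w) by apply: Rdiv_lt_0_compat; lra.
  nra.
have inv : / Rpower v be <= / (a * (1 + be * (w / (1 + w)))).
  by apply: Rinv_le_contravar bv; nra.
suff : / (a * (1 + be * (w / (1 + w)))) + be / (C + 1 + be) <= / a by lra.
have d0 : 0 < C + a * (1 + be) by nra.
have -> : / (a * (1 + be * (w / (1 + w)))) = / a - be / (C + a * (1 + be)).
  by rewrite /w; field; repeat split; nra.
suff : be / (C + 1 + be) <= be / (C + a * (1 + be)) by lra.
apply: Rmult_le_compat_l; first lra.
by apply: Rinv_le_contravar => //; nra.
Qed.

(** Telescoping [e ^ (- be)] gives linear growth, which is then inverted. Positivity of [e t] is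
    required because [Rpower] does not vanish at 0. *)
Lemma sublinear_rate (e : nat -> R) al C T :
  1 / 2 < al < 1 -> 0 < C ->
  (forall t, 0 <= e (S t) <= e t) -> (forall t, (T <= t)%coq_nat -> e t <= 1) ->
  (forall t, (T <= t)%coq_nat -> 0 < e (S t) ->
     Rpower (e (S t)) (2 * al) <= C * (e t - e (S t))) ->
  exists c0, 0 < c0 /\ forall t, ((2 * T)%coq_nat < t)%coq_nat -> 0 < e t ->
    Rpower (e t) (1 - al) <= c0 * Rpower (INR t) (- ((1 - al) / (2 * al - 1))).
Proof.
move=> al01 C0 dec e1 h.
set be := 2 * al - 1; have be0 : 0 < be by rewrite /be; lra.
pose ka := be / (C + 1 + be); have ka0 : 0 < ka by apply: Rdiv_lt_0_compat; lra.
have step k : 0 < e (T + k)%coq_nat -> INR k * ka <= Rpower (e (T + k)%coq_nat) (- be).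
  elim: k => [|k IH] ek; first by rewrite /= Rmult_0_l; exact/Rlt_le/Rpower_gt0.
  rewrite -plus_n_Sm in ek *.
  have d := dec (T + k)%coq_nat; have ek' : 0 < e (T + k)%coq_nat by lra.
  have := h (T + k)%coq_nat ltac:(lia) ek.
  have -> : 2 * al = 1 + be by rewrite /be; ring.
  have eS1 : e (S (T + k)%coq_nat) <= 1 by apply: e1; lia.
  move=> /(sublinear_step be0 C0 (conj ek eS1)).
  have := IH ek'; rewrite S_INR -/ka; lra.
pose q := (1 - al) / be; have q0 : 0 < q by apply: Rdiv_lt_0_compat; lra.
exists (Rpower (ka / 2) (- q)); split; first exact: Rpower_gt0.
move=> t ht et; rewrite -/q.
have tE : t = (T + (t - T)%coq_nat)%coq_nat by lia.
have := step (t - T)%coq_nat; rewrite -tE => /(_ et) st.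
have t0 : 0 < INR t by apply: lt_0_INR; lia.
(* Starting at [2 * T] lets [t - T] be replaced by [t / 2]. *)
have ht2 : INR t / 2 <= INR (t - T)%coq_nat.
  rewrite minus_INR; last lia.
  have := le_INR (2 * T)%coq_nat t ltac:(lia); rewrite mult_INR /=; lra.
rewrite Rpower_mult_distr //; last lra.
have -> : Rpower (e t) (1 - al) = Rpower (Rpower (e t) (- be)) (- q).
  by rewrite Rpower_mult; congr Rpower; rewrite /q; field; lra.
have b0 : 0 < ka / 2 * INR t by nra.
rewrite !(Rpower_Ropp _ q); apply: Rinv_le_contravar; first exact: Rpower_gt0.
by apply: Rle_Rpower_l; [lra | split=> //; nra].
Qed.

(** * Quasi-Fejer monotone descent *)

Section FejerDescent.
Context {n : nat} (D : vec n -> Prop) (F : vec n -> R) (x : nat -> vec n) (c K Lmin M : R).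
Context (c0 : 0 < c) (K0 : 0 <= K) (Lm0 : 0 < Lmin).
Context (Dx : forall t, D (x t)).
Context (descent : forall t,
  F (x (S t)) <= F (x t) - c / 2 * inner (vsub (x (S t)) (x t)) (vsub (x (S t)) (x t))).
Context (estimate : forall t, exists Lam, Lmin <= Lam <= M /\
  forall z, D z -> F (x (S t)) <= F z
    + Lam / 2 * (inner (vsub z (x t)) (vsub z (x t))
                 - inner (vsub z (x (S t))) (vsub z (x (S t))))
    + K * inner (vsub (x (S t)) (x t)) (vsub (x (S t)) (x t))).

(** Calibrated by [2 / Lmin * K = C * (c / 2)], so that the decrease of [C * F] pays for the error
    term in [K]. *)
Let C := 4 * K / (Lmin * c).

Lemma fejer_constant_ge0 : 0 <= C.
Proof. by apply: Rle_mult_inv_pos; [lra | exact: Rmult_lt_0_compat]. Qed.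

(* The Lyapunov function |z - x t|^2 + C * F (x t). *)
Lemma lyapunov_step z t : D z -> F z <= F (x (S t)) ->
  inner (vsub z (x (S t))) (vsub z (x (S t))) + C * F (x (S t))
  <= inner (vsub z (x t)) (vsub z (x t)) + C * F (x t) - 2 / M * (F (x (S t)) - F z).
Proof.
move=> Dz Fz; have [Lam [hL /(_ z Dz) est]] := estimate t.
have desc := descent t.
set N1 := inner (vsub z (x (S t))) _ in est *.
set N0 := inner (vsub z (x t)) _ in est *.
set A := inner _ _ in est desc.
have A0 : 0 <= A := inner_ge0 _.
have iL : 0 < / Lam by apply: Rinv_0_lt_compat; lra.
have h : N1 <= N0 + 2 / Lam * (K * A) - 2 / Lam * (F (x (S t)) - F z).
  have -> : N0 + 2 / Lam * (K * A) - 2 / Lam * (F (x (S t)) - F z)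
    = N1 + 2 / Lam * (F z + Lam / 2 * (N0 - N1) + K * A - F (x (S t))) by field; lra.
  have : 0 <= 2 / Lam * (F z + Lam / 2 * (N0 - N1) + K * A - F (x (S t))).
    by apply: Rmult_le_pos; rewrite /Rdiv; lra.
  lra.
have h1 : 2 / Lam * (K * A) <= C * (F (x t) - F (x (S t))).
  apply: Rle_trans (_ : 2 / Lmin * (K * A) <= _).
    apply: Rmult_le_compat_r; first by nra.
    by apply: Rmult_le_compat_l; [lra | apply: Rinv_le_contravar; lra].
  have -> : 2 / Lmin * (K * A) = C * (c / 2 * A) by rewrite /C; field; lra.
  by apply: Rmult_le_compat_l; [exact: fejer_constant_ge0 | lra].
have h2 : 2 / M * (F (x (S t)) - F z) <= 2 / Lam * (F (x (S t)) - F z).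
  apply: Rmult_le_compat_r; first lra.
  by apply: Rmult_le_compat_l; [lra | apply: Rinv_le_contravar; lra].
lra.
Qed.

(** For a strictly better [z] the Lyapunov function would drop by at least [q] at every step, yet it
    stays above [C * F xbar]. *)
Lemma lower_bound_optimal xbar :
  (forall t, F xbar <= F (x t)) -> forall z, D z -> F xbar <= F z.
Proof.
move=> lb z Dz; apply: Rnot_lt_le => lt0.
have M0 : 0 < M by have [Lam [hL _]] := estimate 0; lra.
pose q := 2 / M * (F xbar - F z).
have q0 : 0 < q by apply: Rmult_lt_0_compat; [apply: Rdiv_lt_0_compat; lra | lra].
pose V t := inner (vsub z (x t)) (vsub z (x t)) + C * F (x t).
have Vt t : V t <= V O - INR t * q.
  elim: t => [|t IH]; first by rewrite /= /V; lra.
  have := @lyapunov_step z t Dz; rewrite S_INR -/(V t) -/(V (S t)).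
  have : q <= 2 / M * (F (x (S t)) - F z).
    apply: Rmult_le_compat_l; first by apply: Rlt_le; apply: Rdiv_lt_0_compat; lra.
    by have := lb (S t); lra.
  have := lb (S t) => h1 h2 /(_ ltac:(lra)); lra.
have [N HN] := INR_unbounded ((V O - C * F xbar) / q).
have := Vt N.
have : V O - C * F xbar < INR N * q.
  have {1}-> : V O - C * F xbar = (V O - C * F xbar) / q * q by field; lra.
  by apply: Rmult_lt_compat_r; lra.
have : C * F xbar <= V N.
  rewrite /V; have := inner_ge0 (vsub z (x N)).
  have := Rmult_le_compat_l _ _ _ fejer_constant_ge0 (lb N); lra.
lra.
Qed.

Lemma quasi_fejer z s t : D z -> (forall k, F z <= F (x k)) -> (t <= s)%coq_nat ->
  inner (vsub z (x s)) (vsub z (x s))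
  <= inner (vsub z (x t)) (vsub z (x t)) + C * (F (x t) - F z).
Proof.
move=> Dz Fz ts.
have M0 : 0 < M by have [Lam [hL _]] := estimate 0; lra.
suff : inner (vsub z (x s)) (vsub z (x s)) + C * F (x s)
       <= inner (vsub z (x t)) (vsub z (x t)) + C * F (x t).
  have := Rmult_le_compat_l _ _ _ fejer_constant_ge0 (Fz s); lra.
elim: ts => [|k _ IH]; first lra.
have := lyapunov_step Dz (Fz (S k)).
have : 0 <= 2 / M * (F (x (S k)) - F z).
  apply: Rmult_le_pos; last by have := Fz (S k); lra.
  by apply: Rlt_le; apply: Rdiv_lt_0_compat; lra.
lra.
Qed.

Lemma quasi_fejer_norm z s t : D z -> (forall k, F z <= F (x k)) -> (t <= s)%coq_nat ->
  vnorm (vsub z (x s)) <= vnorm (vsub z (x t)) + sqrt (C * (F (x t) - F z)).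
Proof.
move=> Dz Fz ts; have h := quasi_fejer Dz Fz ts.
have p : 0 <= C * (F (x t) - F z).
  by apply: Rmult_le_pos fejer_constant_ge0 _; have := Fz t; lra.
have := sqrt_pos (C * (F (x t) - F z)); have := vnorm_ge0 (vsub z (x t)).
move=> h1 h2; apply: vnorm_le_sq; first lra.
have := sqrt_sqrt _ p; rewrite -!vnorm_sq in h *; nra.
Qed.

(** Once one iterate is close to [xbar] in both position and value, the quasi-Fejer bound keeps all
    later ones close. *)
Lemma cluster_point_is_limit xbar (phi : nat -> nat) :
  D xbar -> (forall t, F xbar <= F (x t)) -> continuous_fun F ->
  (forall k, (k <= phi k)%coq_nat) -> vconv (fun k => x (phi k)) xbar -> vconv x xbar.
Proof.
move=> Db lb cF hphi cv eps e0.
have cvF := continuous_fun_cv cF cv.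
have [N1 H1] := cv (eps / 2) ltac:(lra).
have d0 : 0 < eps * eps / (4 * (C + 1)).
  by have := fejer_constant_ge0; move=> ?; apply: Rdiv_lt_0_compat; nra.
have [N2 H2] := cvF _ d0.
pose k := (N1 + N2)%coq_nat.
have := H1 k ltac:(rewrite /k; lia); have := H2 k ltac:(rewrite /k; lia).
rewrite /R_dist /Rdist Rminus_0_r Rabs_pos_eq; last by have := lb (phi k); lra.
rewrite Rabs_pos_eq; last exact: vnorm_ge0.
move=> h2 h1; exists (phi k) => s hs.
rewrite /R_dist /Rdist Rminus_0_r Rabs_pos_eq; last exact: vnorm_ge0.
rewrite vnorm_subC.
apply: Rle_lt_trans (quasi_fejer_norm Db lb hs) _.
rewrite vnorm_subC.
suff : sqrt (C * (F (x (phi k)) - F xbar)) < eps / 2 by lra.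
have -> : eps / 2 = sqrt (eps / 2 * (eps / 2)) by rewrite sqrt_square; lra.
have C0 := fejer_constant_ge0.
apply: sqrt_lt_1_alt; split.
  by apply: Rmult_le_pos C0 _; have := lb (phi k); lra.
have : (C + 1) * (F (x (phi k)) - F xbar) < eps * eps / 4.
  have -> : eps * eps / 4 = (C + 1) * (eps * eps / (4 * (C + 1))) by field; lra.
  by apply: Rmult_lt_compat_l; lra.
have := lb (phi k); nra.
Qed.

Lemma dist_to_limit xbar p t : vconv x xbar -> D p -> (forall k, F p <= F (x k)) ->
  vnorm (vsub (x t) xbar) <= 2 * vnorm (vsub (x t) p) + sqrt (C * (F (x t) - F p)).
Proof.
move=> cv Dp Fp.
suff : vnorm (vsub p xbar) <= vnorm (vsub p (x t)) + sqrt (C * (F (x t) - F p)).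
  have := vnorm_triangle p (x t) xbar; rewrite (vnorm_subC p (x t)); lra.
apply: le_epsilon => eps e0; have [N HN] := cv eps e0.
have := HN (N + t)%coq_nat ltac:(lia).
rewrite /R_dist /Rdist Rminus_0_r Rabs_pos_eq; last exact: vnorm_ge0.
have := @quasi_fejer_norm p (N + t)%coq_nat t Dp Fp ltac:(lia).
have := vnorm_triangle (x (N + t)%coq_nat) p xbar; lra.
Qed.

(** The estimate at a minimizer [p] near [x (S t)] bounds the gap by the step length [a] and the
    distance [d] to [p]; the error bound controls [d], and sufficient decrease controls [a]. Zero
    gaps are stated separately on account of [Rpower]. *)
Lemma KL_decrease xbar al : continuous_fun F ->
  (forall (z : nat -> vec n) l, (forall k, D (z k)) -> vconv z l -> D l) ->
  D xbar -> (forall t, F xbar <= F (x t)) -> (forall z, D z -> F xbar <= F z) ->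
  vconv x xbar -> 1 / 2 <= al < 1 -> KL_at D F al xbar ->
  exists T C1, 0 < C1 /\ forall t, (T <= t)%coq_nat ->
    [/\ F (x t) - F xbar <= 1,
        0 < F (x (S t)) - F xbar ->
          Rpower (F (x (S t)) - F xbar) (2 * al) <= C1 * (F (x t) - F (x (S t))),
        0 < F (x t) - F xbar ->
          vnorm (vsub (x t) xbar) <= C1 * Rpower (F (x t) - F xbar) (1 - al)
      & F (x t) - F xbar = 0 -> vnorm (vsub (x t) xbar) <= 0].
Proof.
move=> cF Dcl Db lb mini cv al01 KL.
have [r [eta [A [r0 [eta0 [A0 EB]]]]]] := @KL_error_bound n D F al xbar ltac:(lra) cF Dcl KL.
have [N1 H1] := cv r r0.
have [N2 H2] := continuous_fun_cv cF cv (Rmin_pos _ _ eta0 Rlt_0_1).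
have M0 : 0 < M by have [Lam [hL _]] := estimate 0; lra.
have C0 := fejer_constant_ge0.
have eT t : (N2 <= t)%coq_nat -> F (x t) - F xbar < Rmin eta 1.
  move=> ht; have := H2 t ltac:(lia); rewrite /R_dist /Rdist.
  by rewrite Rabs_pos_eq //; have := lb t; lra.
have bound t : ((N1 + N2)%coq_nat <= t)%coq_nat -> 0 < F (x t) - F xbar ->
    exists p, D p /\ F p = F xbar /\
      vnorm (vsub (x t) p) <= A * Rpower (F (x t) - F xbar) (1 - al).
  move=> ht et; have := H1 t ltac:(lia).
  rewrite /R_dist /Rdist Rminus_0_r Rabs_pos_eq; last exact: vnorm_ge0.
  have := eT t ltac:(lia); have := Rmin_l eta 1.
  move=> m1 e1 nr; have [|p [Dp [Fp hp]]] := EB (x t) (Dx t) nr; first lra.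
  exists p; split=> //; split=> //; apply: Rle_antisym => //; exact: mini.
(* Comes from absorbing the cross term by [2 * M * A * a * H <= H^2 + (M * A * a)^2]. *)
pose B := (M * A) * (M * A) + M + 2 * K.
have MA0 : 0 < M * A by exact: Rmult_lt_0_compat.
have B0 : 0 < B by rewrite /B; nra.
have s0 := sqrt_pos C.
have q0 : 0 < B * (2 / c) by apply: Rmult_lt_0_compat => //; apply: Rdiv_lt_0_compat; lra.
exists (N1 + N2)%coq_nat, (B * (2 / c) + (2 * A + sqrt C)); split; first lra.
move=> t ht; have em := eT t ltac:(lia); have m1 := Rmin_r eta 1.
have le1 : F (x t) - F xbar <= 1 by lra.
split=> //.
- move=> e0; have [p [Dp [Fp hp]]] := bound (S t) ltac:(lia) e0.
  have [Lam [hL /(_ p Dp)]] := estimate t; rewrite Fp => est.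
  set e := F (x (S t)) - F xbar in e0 hp *.
  have e1 : e <= 1 by have := eT (S t) ltac:(lia); rewrite -/e; lra.
  pose a := vnorm (vsub (x (S t)) (x t)); have a0 : 0 <= a := vnorm_ge0 _.
  pose d := vnorm (vsub (x (S t)) p); have d0 : 0 <= d := vnorm_ge0 _.
  have desc := descent t.
  rewrite -!vnorm_sq -/a (vnorm_subC p (x (S t))) -/d in est desc.
  have tri : vnorm (vsub p (x t)) <= d + a.
    by have := vnorm_triangle (x (S t)) p (x t); rewrite (vnorm_subC p (x (S t))).
  have n0 := vnorm_ge0 (vsub p (x t)).
  have base : e <= M * a * d + (M / 2 + K) * (a * a).
    have h1 : vnorm (vsub p (x t)) * vnorm (vsub p (x t)) - d * d <= 2 * a * d + a * a
      by nra.
    have : Lam / 2 * (vnorm (vsub p (x t)) * vnorm (vsub p (x t)) - d * d)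
           <= M / 2 * (2 * a * d + a * a).
      apply: Rle_trans (_ : Lam / 2 * (2 * a * d + a * a) <= _).
        by apply: Rmult_le_compat_l => //; lra.
      by apply: Rmult_le_compat_r; [nra | lra].
    rewrite /e; lra.
  pose H := Rpower e al; have H0 : 0 < H := Rpower_gt0 _ _.
  (* Multiplying [base] by [G] turns [e] into [H^2] and the bound on [d] into [A * H]; [G <= 1] uses
     [al >= 1 / 2]. *)
  pose G := Rpower e (2 * al - 1); have G0 : 0 < G := Rpower_gt0 _ _.
  have G1 : G <= 1.
    rewrite -[X in _ <= X](Rpower_O e) //; apply: Rpower_le_exponent; lra.
  have EG : Rpower e (1 - al) * G = H.
    by rewrite /G -Rpower_plus; congr Rpower; ring.
  have eG : e * G = H * H.
    rewrite /H -Rpower_plus /G -{1}(Rpower_1 e) // -Rpower_plus; congr Rpower; ring.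
  have -> : Rpower e (2 * al) = H * H.
    by rewrite /H -Rpower_plus; congr Rpower; ring.
  have dG : d * G <= A * H.
    by rewrite -EG -Rmult_assoc; apply: Rmult_le_compat_r; [lra | exact: hp].
  have HH : H * H <= M * a * (A * H) + (M / 2 + K) * (a * a).
    rewrite -eG.
    apply: Rle_trans (Rmult_le_compat_r _ _ _ (Rlt_le _ _ G0) base) _.
    have : M * a * (d * G) <= M * a * (A * H) by apply: Rmult_le_compat_l => //; nra.
    have : (M / 2 + K) * (a * a) * G <= (M / 2 + K) * (a * a).
      have : 0 <= (M / 2 + K) * (a * a) by apply: Rmult_le_pos; nra.
      nra.
    lra.
  have HB : H * H <= B * (a * a).
    have : 0 <= (H - M * A * a) * (H - M * A * a) by have := Rle_0_sqr (H - M * A * a).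
    rewrite /B; nra.
  have aa : a * a <= 2 / c * (F (x t) - F (x (S t))).
    have -> : a * a = 2 / c * (c / 2 * (a * a)) by field; lra.
    by apply: Rmult_le_compat_l; [apply: Rlt_le; apply: Rdiv_lt_0_compat; lra | lra].
  have dF : 0 <= F (x t) - F (x (S t)) by nra.
  apply: Rle_trans HB _.
  apply: Rle_trans (Rmult_le_compat_l _ _ _ (Rlt_le _ _ B0) aa) _; nra.
- move=> e0; have [p [Dp [Fp hp]]] := bound t ht e0.
  have := @dist_to_limit xbar p t cv Dp.
  rewrite Fp => /(_ lb).
  set e := F (x t) - F xbar in e0 hp le1 *.
  rewrite sqrt_mult_alt // -(Rpower_sqrt e) //.
  have : Rpower e (/ 2) <= Rpower e (1 - al) by apply: Rpower_le_exponent; lra.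
  have := Rpower_gt0 e (1 - al) => pe h1 h2.
  have := Rmult_le_compat_l _ _ _ s0 h1.
  have : 0 < B * (2 / c) * Rpower e (1 - al) by exact: Rmult_lt_0_compat.
  lra.
(* At zero gap [x t] itself serves as the minimizer [p], so both terms of the bound vanish. *)
move=> e0; have := @dist_to_limit xbar (x t) t cv (Dx t).
have -> : F (x t) = F xbar by lra.
move=> /(_ lb); rewrite vnorm_subxx (_ : F xbar - F xbar = 0); last ring.
rewrite !Rmult_0_r sqrt_0; lra.
Qed.

End FejerDescent.

(** * Rates of convergence *)

Lemma convex_descent_common {n m} (g : 'I_m -> vec n -> R) dg :
  (forall i, convex_fun (g i)) -> (forall i x, has_grad (g i) x (dg i x)) ->
  (forall i, exists L, lipschitz_map (dg i) L) ->
  exists K, 0 < K /\ forall i x z,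
    g i z <= g i x + inner (dg i x) (vsub z x) + K * inner (vsub z x) (vsub z x).
Proof.
move=> cg gg lg; have [L HL] := @fin_all_exists _ (fun _ => R) _ lg.
have [K [K0 HK]] := ord_common_bound (fun i => Rabs (L i)).
exists K; split=> // i x z.
apply: Rle_trans (convex_descent (cg i) (gg i) (HL i) x z) _.
by have := HK i; have := inner_ge0 (vsub z x); nra.
Qed.

Lemma KL_rates {n} (D : vec n -> Prop) (F : vec n -> R) (x : nat -> vec n) xbar
    c K Lmin M al :
  0 < c -> 0 <= K -> 0 < Lmin -> (forall t, D (x t)) ->
  (forall t, F (x (S t))
     <= F (x t) - c / 2 * inner (vsub (x (S t)) (x t)) (vsub (x (S t)) (x t))) ->
  (forall t, exists Lam, Lmin <= Lam <= M /\
    forall z, D z -> F (x (S t)) <= F z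
      + Lam / 2 * (inner (vsub z (x t)) (vsub z (x t))
                   - inner (vsub z (x (S t))) (vsub z (x (S t))))
      + K * inner (vsub (x (S t)) (x t)) (vsub (x (S t)) (x t))) ->
  continuous_fun F ->
  (forall (z : nat -> vec n) l, (forall k, D (z k)) -> vconv z l -> D l) ->
  D xbar -> (forall t, F xbar <= F (x t)) -> (forall z, D z -> F xbar <= F z) ->
  vconv x xbar -> 0 <= al < 1 -> KL_at D F al xbar ->
  (al <= 1 / 2 -> exists c0 Q1 (tbar : nat), 0 < c0 /\ 0 < Q1 < 1 /\ (1 <= tbar)%N /\
     forall t, (tbar < t)%N -> vnorm (vsub (x t) xbar) <= c0 * Q1 ^ t) /\
  (1 / 2 < al -> exists c0 (tbar : nat), 0 < c0 /\ (1 <= tbar)%N /\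
     forall t, (tbar < t)%N ->
       vnorm (vsub (x t) xbar) <= c0 * Rpower (INR t) (- ((1 - al) / (2 * al - 1)))).
Proof.
move=> c0 K0 L0 Dx desc est cF Dcl Db lb mini cv al01 KL.
have main be := @KL_decrease n D F x c K Lmin M c0 K0 L0 Dx desc est xbar be
  cF Dcl Db lb mini cv.
pose e t := F (x t) - F xbar.
have e0 t : 0 <= e t by have := lb t; rewrite /e; lra.
have eS t : e (S t) <= e t.
  by have := desc t; have := inner_ge0 (vsub (x (S t)) (x t)); rewrite /e; nra.
have diffE t : F (x t) - F (x (S t)) = e t - e (S t) by rewrite /e; ring.
split=> al12.
  have [T [C [C0 HT]]] := main (1 / 2) ltac:(lra)
    (@KL_at_exponent_mono n D F al (1 / 2) xbar ltac:(lra) KL).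
  have lin t : (T <= t)%coq_nat -> e (S t) <= C * (e t - e (S t)).
    move=> tT; have [_ h _ _] := HT t tT; rewrite diffE in h.
    case: (e0 (S t)) => [ep|<-]; last by have := e0 t; nra.
    have := h ep; have -> : 2 * (1 / 2) = 1 by field.
    by rewrite Rpower_1.
  have rate := linear_rate C0 lin.
  set q := C / (1 + C) in rate.
  have q0 : 0 < q by apply: Rdiv_lt_0_compat; lra.
  have q1 : q < 1 by apply: (Rmult_lt_reg_r (1 + C)); rewrite /q; [lra | field_simplify; lra].
  (* Distances are of the order of the square root of the gap, so their ratio is [sqrt q]. *)
  pose Q := sqrt q; have Q0 : 0 < Q := sqrt_lt_R0 _ q0.
  have QQ : Q * Q = q by apply: sqrt_sqrt; lra.
  have QT : 0 < / Q ^ T by apply: Rinv_0_lt_compat; exact: pow_lt.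
  have s0 := sqrt_pos (e T).
  have CT : 0 < C * (sqrt (e T) + 1) by apply: Rmult_lt_0_compat; lra.
  (* [/ Q ^ T] converts a rate in [t - T] into one in [t]; the added 1 keeps the constant positive
     if [e T = 0]. *)
  exists (C * (sqrt (e T) + 1) * / Q ^ T), Q, (S T).
  split; first exact: Rmult_lt_0_compat.
  split; first by split=> //; nra.
  split=> // t /ltP tT.
  have [k tE] : exists k, t = (T + k)%coq_nat by exists (t - T)%coq_nat; lia.
  have Qk : 0 < Q ^ k by exact: pow_lt.
  have -> : C * (sqrt (e T) + 1) * / Q ^ T * Q ^ t = C * ((sqrt (e T) + 1) * Q ^ k).
    by rewrite tE pow_add; field; apply: pow_nonzero; lra.
  have [_ _ h1 h2] := HT t ltac:(lia).
  case: (e0 t) => [ep|ez]; last first.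
    apply: Rle_trans (h2 (esym ez)) _.
    by apply: Rmult_le_pos; [lra | apply: Rmult_le_pos; lra].
  apply: Rle_trans (h1 ep) _; apply: Rmult_le_compat_l; first lra.
  have -> : 1 - 1 / 2 = / 2 by field.
  rewrite Rpower_sqrt //.
  apply: Rle_trans (sqrt_le_1_alt _ (e T * q ^ k) _) _; first by rewrite tE; exact: rate.
  rewrite sqrt_mult_alt // -QQ Rpow_mult_distr sqrt_square; last lra.
  by apply: Rmult_le_compat_r; lra.
have [T [C [C0 HT]]] := main al ltac:(lra) KL.
have [|t tT|t tT ep|c1 [c10 Hc1]] := @sublinear_rate e al C T ltac:(lra) C0.
- by move=> t; split.
- by have [] := HT t tT.
- by have [_ + _ _] := HT t tT; rewrite diffE; apply.
exists (C * c1), (S (2 * T)%coq_nat).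
split; first exact: Rmult_lt_0_compat.
split=> // t /ltP tT; have [_ _ h1 h2] := HT t ltac:(lia).
case: (e0 t) => [ep|ez]; last first.
  apply: Rle_trans (h2 (esym ez)) _.
  by apply: Rmult_le_pos; [nra | exact/Rlt_le/Rpower_gt0].
apply: Rle_trans (h1 ep) _; rewrite Rmult_assoc.
by apply: Rmult_le_compat_l; [lra | apply: Hc1; [lia | exact: ep]].
Qed.

(** * Convergence of the algorithm *)

Lemma feasible_closed {n m} (g : 'I_m -> vec n -> R) :
  (forall i, continuous_fun (g i)) -> forall (z : nat -> vec n) l,
  (forall k, feasible g (z k)) -> vconv z l -> feasible g l.
Proof.
move=> cg z l fz cv i.
by apply: Un_cv_le (continuous_fun_cv (cg i) cv) => k; exact: fz.
Qed.

Lemma continuous_fun_Fval {n} (f P1 P2 : vec n -> R) :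
  continuous_fun f -> continuous_fun P1 -> continuous_fun P2 ->
  continuous_fun (Fval f P1 P2).
Proof.
move=> cf c1 c2 x eps e0; have e3 : 0 < eps / 3 by lra.
have [d [d0 Hd]] := cf x _ e3; have [d1 [d10 Hd1]] := c1 x _ e3.
have [d2 [d20 Hd2]] := c2 x _ e3.
exists (Rmin d (Rmin d1 d2)); split; first by do !apply: Rmin_pos.
move=> y hy; have m1 := Rmin_l d (Rmin d1 d2); have m2 := Rmin_r d (Rmin d1 d2).
have m3 := Rmin_l d1 d2; have m4 := Rmin_r d1 d2.
have := Hd y ltac:(lra); have := Hd1 y ltac:(lra); have := Hd2 y ltac:(lra).
rewrite /Fval; split_Rabs; lra.
Qed.

(** Places the limit in the domain of the subdifferential, where the KL hypothesis is available. *)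
Lemma minimizer_limiting_sub {n} (D : vec n -> Prop) (F : vec n -> R) xbar :
  D xbar -> (forall z, D z -> F xbar <= F z) -> limiting_sub D F xbar vzero.
Proof.
move=> Db mini; apply: frechet_limiting; split=> // eps e0.
exists 1; split=> [|y Dy _]; first lra.
have -> : @vzero n = vscale 0 xbar by vec_ring.
rewrite inner_scalel; have := mini y Dy; have := vnorm_ge0 (vsub y xbar); nra.
Qed.

Theorem mainTheorem9 (n m : nat)
  (f P1 P2 : vec n -> R) (df : vec n -> vec n)
  (g : 'I_m -> vec n -> R) (dg : 'I_m -> vec n -> vec n)
  (* problem (P) standing assumptions *)
  (Hf_grad : forall x, has_grad f x (df x))
  (Hdf_cont : continuous_map df)
  (HP1_conv : convex_fun P1) (HP1_cont : continuous_fun P1)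
  (HP2_conv : convex_fun P2) (HP2_cont : continuous_fun P2)
  (Hg_cont : forall i, continuous_fun (g i))
  (Hfeas : exists x, feasible g x)
  (* Assumption A *)
  (HA1 : exists Lf, lipschitz_map df Lf)
  (HA2 : forall i, (forall x, has_grad (g i) x (dg i x)) /\
                   exists Lgi, lipschitz_map (dg i) Lgi)
  (HA3 : level_bounded (feasible g) (Fval f P1 P2))
  (* Assumption B (MFCQ) *)
  (HB1 : forall i, continuous_map (dg i))
  (HB2 : forall x, feasible g x -> exists d : vec n,
           forall i, g i x = 0 -> inner (dg i x) d < 0)
  (* Assumption E *)
  (HE1 : forall x, P2 x = 0)
  (HE2 : convex_fun f) (HE3 : forall i, convex_fun (g i))
  (* parameters of SCP_ls and a generated sequence *)
  (c Lmin Lmax tau : R) (Hc : 0 < c) (HL : 0 < Lmin < Lmax) (Htau : 1 < tau)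
  (x : nat -> vec n)
  (Hx : SCP_ls_sequence f P1 P2 df g dg c Lmin Lmax tau x) :
  exists xstar : vec n,
    is_minimizer f P1 P2 g xstar /\ vconv x xstar /\
    forall alpha, 0 <= alpha < 1 ->
      KL_function (feasible g) (Fval f P1 P2) alpha ->
      (alpha <= 1/2 ->
         exists c0 Q1 (tbar : nat), 0 < c0 /\ 0 < Q1 < 1 /\ (1 <= tbar)%N /\
           forall t, (tbar < t)%N -> vnorm (vsub (x t) xstar) <= c0 * Q1 ^ t) /\
      (1/2 < alpha ->
         exists c0 (tbar : nat), 0 < c0 /\ (1 <= tbar)%N /\
           forall t, (tbar < t)%N ->
             vnorm (vsub (x t) xstar)
               <= c0 * Rpower (INR t) (- ((1 - alpha) / (2 * alpha - 1)))).
Proof.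
have HF : continuous_fun (Fval f P1 P2).
  exact: continuous_fun_Fval (has_grad_continuous Hf_grad) HP1_cont HP2_cont.
have [L HLip] := HA1.
have fu := convex_descent HE2 Hf_grad HLip.
have fl x1 z := convex_grad_ineq HE2 (Hf_grad x1) z.
have gg i := (HA2 i).1.
have [Kg [Kg0 gu]] := convex_descent_common HE3 gg (fun i => (HA2 i).2).
have gl i x1 z := convex_grad_ineq (HE3 i) (gg i x1) z.
set K := Rabs L in fu; have K0 : 0 <= K := Rabs_pos L.
have [x0 fx0] := Hfeas.
have [xhat [delta [d0 gh]]] := slater_point gg Hg_cont HE3 fx0 (HB2 x0 fx0).
have [fxO step] := Hx.
have fx t : feasible g (x t).
  case: t => [//|t]; have [xi [_ [N [? [? [? [_ [_ [_ [_ [[? _] ->]]]]]]]]]]] := step t.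
  by [].
have par t := @scp_step_parameters n m f P1 P2 df g dg c Lmin Lmax tau K Kg (x t) (x (S t))
  HE1 fu gu K0 Kg0 Hc HL Htau (fx t) (step t).
have desc t : Fval f P1 P2 (x (S t)) <= Fval f P1 P2 (x t)
    - c / 2 * inner (vsub (x (S t)) (x t)) (vsub (x (S t)) (x t)).
  by have [xi [Lf [Lg [_ [_ [_ [_ [_ ?]]]]]]]] := par t.
have mono t : Fval f P1 P2 (x (S t)) <= Fval f P1 P2 (x t).
  by have := desc t; have := inner_ge0 (vsub (x (S t)) (x t)); nra.
have Dcl := feasible_closed Hg_cont.
have [xbar [phi [Db [lb [hphi cvphi]]]]] := decreasing_cluster Dcl HF HA3 fx mono.
have [B HB] := HA3 (Fval f P1 P2 (x O)).
have FO t : Fval f P1 P2 (x t) <= Fval f P1 P2 (x O).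
  by elim: t => [|t IH]; [lra | have := mono t; lra].
have xB t : vnorm (x t) <= B by apply: HB.
have B0 : 0 <= B by exact: Rle_trans (vnorm_ge0 _) (xB O).
pose R0 := vnorm xhat + B + 1.
have nh := vnorm_ge0 xhat.
have ball u t : vnorm u <= vnorm xhat + B ->
    inner (vsub u (x t)) (vsub u (x t)) <= (R0 + B) * (R0 + B).
  move=> hu; rewrite -vnorm_sq.
  have h : vnorm (vsub u (x t)) <= R0 + B.
    have := vnorm_triangle vzero u (x t); have := xB t.
    have -> : vsub u vzero = u by vec_ring.
    have -> : vnorm (vsub vzero (x t)) = vnorm (x t).
      by rewrite vnorm_subC; congr vnorm; vec_ring.
    rewrite /R0; lra.
  by apply: Rmult_le_compat => //; exact: vnorm_ge0.
(* One bound, uniform in [t], for the squared distances from [x t] to [xhat] and to [x (S t)]. *)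
set BB := (R0 + B) * (R0 + B) in ball.
have BB0 : 0 < BB by rewrite /BB /R0; nra.
pose Mf := Lmax + tau * (2 * K + c); pose Mg := (1 + tau * (2 * Kg / Lmin)) * Lmax.
have Mg0 : 0 < Mg.
  apply: Rmult_lt_0_compat; last lra.
  have : 0 < 2 * Kg / Lmin by apply: Rdiv_lt_0_compat; lra.
  nra.
pose sigma := Rmin 1 (delta / (Mg * BB)).
have MB0 : 0 < Mg * BB by exact: Rmult_lt_0_compat.
have s0 : 0 < sigma by apply: Rmin_pos; [lra | exact: Rdiv_lt_0_compat].
have sB : sigma * (Mg * BB) <= delta.
  have -> : delta = delta / (Mg * BB) * (Mg * BB) by field; lra.
  by apply: Rmult_le_compat_r; [lra | exact: Rmin_r].
pose F0 := Rmax (Fval f P1 P2 (x O)) (Fval f P1 P2 xhat).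
(* The upper bound on [Lam] obtained here does not depend on [t]; it becomes the constant [M] of the
   descent analysis. *)
have est t := let: ex_intro xi (ex_intro Lf (ex_intro Lg
    (conj xi0 (conj hf (conj hg (conj sol _)))))) := par t in
  @scp_subproblem_estimate n m f P1 P2 df g dg K Lmin Mf Mg BB delta sigma F0
    (Fval f P1 P2 xbar) xhat (x t) xi (x (S t)) Lf Lg HP1_conv HE2 HE1 xi0 fl fu gl
    (proj1 HL) K0 d0 (conj s0 (Rmin_l _ _)) sB gh hf hg Mg0 (fx t)
    (ball xhat t ltac:(lra)) (ball (x (S t)) t ltac:(have := xB (S t); lra))
    (Rle_trans _ _ _ (FO t) (Rmax_l _ _)) (Rmax_r _ _) (lb (S t)) sol.
have L0 := proj1 HL.
have mini := @lower_bound_optimal n _ _ x c K Lmin _ Hc K0 L0 desc est xbar lb.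
have cv := @cluster_point_is_limit n _ _ x c K Lmin _ Hc K0 L0 desc est xbar phi
  Db lb HF hphi cvphi.
exists xbar; split=> //; split=> // alpha al01 KLF.
apply: (KL_rates Hc K0 L0 fx desc est HF Dcl Db lb mini cv al01).
by apply: KLF; exists vzero; exact: minimizer_limiting_sub.
Qed.
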